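(* Let $d\ge1$ and let $\gamma^{(n)}_2$ be the spectral gap of the normalized Laplacian $\mathcal{L}_{n,r}$. The following holds almost surely. (1) If $r=1$, then $\lim_{n\to\infty}\gamma^{(n)}_2=\frac12$. (2) If $r\in(1,2)$, then $$\tfrac12<\liminf_{n\to\infty}\gamma^{(n)}_2\le\limsup_{n\to\infty}\gamma^{(n)}_2<1.$$ (3) If $r\in(0,1)$, then $$0<\liminf_{n\to\infty}\gamma^{(n)}_2\le\limsup_{n\to\infty}\gamma^{(n)}_2<\tfrac12.$$
   Context: Let $X_1,X_2,\ldots$ be i.i.d. uniformly distributed random points in $[-1,1]^d$, and let $\|x\|=\max_{1\le k\le d}|x_k|$ for $x\in\mathbb{R}^d$. The number $r>0$ is fixed, independent of $n$. Let $h_r(x,y)=1$ if $\|x-y\|\le r$ and $h_r(x,y)=0$ otherwise. Let $A_{n,r}$ be the $n\times n$ matrix with entries $(A_{n,r})_{i,j}=h_r(X_i,X_j)$ (including $i=j$), let $D_{n,r}=\mathrm{diag}(d_1,\ldots,d_n)$ with $d_i=\sum_{j=1}^n (A_{n,r})_{i,j}$, and let $\mathcal{L}_{n,r}=I_n-D_{n,r}^{-1/2}A_{n,r}D_{n,r}^{-1/2}$ be the symmetrically normalized graph Laplacian. Let $\gamma^{(n)}_1\le\gamma^{(n)}_2\le\cdots\le\gamma^{(n)}_n$ be the eigenvalues of $\mathcal{L}_{n,r}$ counted with multiplicity; $\gamma^{(n)}_2$ is called the spectral gap. *)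

(* Defs.v *)
From HB Require Import structures.
From mathcomp Require Import all_boot all_order all_algebra.
From mathcomp Require Import all_classical all_reals all_analysis.
From mathcomp Require polyrcf.

Set Implicit Arguments.
Unset Strict Implicit.
Unset Printing Implicit Defensive.
Import Order.TTheory GRing.Theory Num.Theory.
Import numFieldNormedType.Exports.
Local Open Scope classical_set_scope.
Local Open Scope ring_scope.

Definition borel_rV (R : realType) (d : nat) : set (set 'rV[R]_d) :=
  <<s [set U : set 'rV[R]_d | open U] >>.

(* The d-dimensional Lebesgue measure on Borel sets, as the d-fold product of
   the one-dimensional one: [product_measure1] unfolded along R^(1+d) = R x R^d,
   the measure of a point in dimension 0 being 1. *)
Fixpoint lebesgue_rV (R : realType) (d : nat) : set 'rV[R]_d -> \bar R :=
  match d return set 'rV[R]_d -> \bar R with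
  | 0 => fun B => (\1_B (0 : 'rV[R]_0))%:E
  | d'.+1 => fun B =>
      (\int[@lebesgue_measure R]_x
         @lebesgue_rV R d'
           [set v | B (row_mx (const_mx x : 'rV[R]_1) v : 'rV[R]_d'.+1)])%E
  end.

Definition cube (R : realType) (d : nat) : set 'rV[R]_d :=
  [set x | forall k, -1 <= x ord0 k <= 1].

(* The cube has Lebesgue measure 2 ^ d. *)
Definition uniform_cube (R : realType) (d : nat) (B : set 'rV[R]_d) : \bar R :=
  (((2 ^+ d)^-1)%:E * lebesgue_rV (B `&` @cube R d))%E.

Definition random_vector (disp : measure_display) (T : measurableType disp)
    (R : realType) (d : nat) (Y : T -> 'rV[R]_d) : Prop :=
  forall B, @borel_rV R d B -> measurable (Y @^-1` B).

Definition mutually_independent (disp : measure_display)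
    (T : measurableType disp) (R : realType) (P : probability T R) (d : nat)
    (X : nat -> T -> 'rV[R]_d) : Prop :=
  forall (J : seq nat) (B : nat -> set 'rV[R]_d), uniq J ->
    (forall i, i \in J -> @borel_rV R d (B i)) ->
    P (\bigcap_(i in [set` J]) (X i @^-1` B i))
      = (\prod_(i <- J) P (X i @^-1` B i))%E.

Definition iid_uniform_cube (disp : measure_display) (T : measurableType disp)
    (R : realType) (P : probability T R) (d : nat)
    (X : nat -> T -> 'rV[R]_d) : Prop :=
  [/\ forall i, random_vector (X i),
      mutually_independent P X
    & forall i B, @borel_rV R d B -> P (X i @^-1` B) = uniform_cube B].

(* The norm on row vectors is the maximum norm. *)
Definition h (R : realType) (d : nat) (r : R) (x y : 'rV[R]_d) : R :=
  if `|x - y| <= r then 1 else 0.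

Definition adjacency (R : realType) (d : nat) (r : R) (x : nat -> 'rV[R]_d)
    (n : nat) : 'M[R]_n :=
  \matrix_(i < n, j < n) h r (x i) (x j).

Definition degree (R : realType) (d : nat) (r : R) (x : nat -> 'rV[R]_d)
    (n : nat) (i : 'I_n) : R :=
  \sum_(j < n) adjacency r x n i j.

Definition laplacian (R : realType) (d : nat) (r : R) (x : nat -> 'rV[R]_d)
    (n : nat) : 'M[R]_n :=
  let Dm12 : 'M[R]_n := diag_mx (\row_i (Num.sqrt (degree r x i))^-1) in
  1%:M - Dm12 *m adjacency r x n *m Dm12.

(* The nondecreasing list of the (real) eigenvalues, repeated according to their
   multiplicity: [rootsR] is the increasing list of the distinct real roots. *)
Definition eigenvalues (R : realType) (n : nat) (M : 'M[R]_n) : seq R :=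
  flatten [seq nseq (mup a (char_poly M)) a
          | a <- polyrcf.rootsR (char_poly M)].

(* Second smallest eigenvalue; lists are numbered from 0, and the default value
   0 is only relevant for n < 2. *)
Definition spectral_gap (R : realType) (d : nat) (r : R) (x : nat -> 'rV[R]_d)
    (n : nat) : R :=
  nth 0 (eigenvalues (laplacian r x n)) 1.

(* Main.v *)
(** The random walk on the graph is close to averaging over boxes of a grid: by
    the law of large numbers the cells of a fine grid of the cube receive almost
    equal numbers of points, and for the maximum norm the neighbours of a point
    are, up to a thin shell, the points of a box of cells.  Such a box average is
    a product of one-dimensional window averages on [-1, 1].

    Lower bounds on gamma2 = 1 - lambda.  A window average preserves monotone
    functions, so it contracts Lipschitz constants relative to a nondecreasing
    potential W by the factor kappa as soon as it does so for W itself.  If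
    r >= 1, let W have constant slope except on the central interval, where the
    window is all of [-1, 1]: then kappa = 1 - r / 2.  If r <= 1, W = 9 y - y^3
    gives kappa = 1 - r^2 / 9.  After many averagings the oscillation decays like
    a power of kappa, whereas that of a lambda-eigenfunction, which is orthogonal
    to the constants and so changes sign, decays like the same power of lambda.
    Hence lambda <= kappa in the limit.

    Upper bounds.  The Rayleigh quotient of the first coordinate is used: its
    window average m(y) satisfies y m(y) >= (1 - r / 2) y^2 if r <= 1, and
    y m(y) >= 0, strictly near the ends, if r < 2. *)

Require Import Defs.
From HB Require Import structures.
From mathcomp Require Import all_boot all_order all_algebra.
From mathcomp Require Import spectral sesquilinear.
From mathcomp Require polyrcf complex.
From mathcomp Require Import all_classical all_reals all_analysis.
From mathcomp Require Import measurable_realfun.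
From mathcomp Require Import ring lra zify.

Set Implicit Arguments.
Unset Strict Implicit.
Unset Printing Implicit Defensive.
Import Order.TTheory GRing.Theory Num.Theory.
Import numFieldNormedType.Exports.
Local Open Scope ring_scope.

(** * Spectrum of a symmetric matrix *)

(** Randomness enters only through [well_spread]: almost surely, for every resolution [q], each cell
    count is eventually within a relative error [1 / q.+1] of its mean. The bounds on the gap are
    deterministic consequences, and [q] depends on the tolerance alone, not on n.

    An eigenfunction on the sample has no regularity between nearby points, so no limit of
    eigenfunctions is taken. Its cell means satisfy the eigenvalue equation of the box average up to
    a uniform error, and one box average already makes them Lipschitz. Under s further averagings
    the main term decays geometrically while the error grows linearly in s. Hence s is fixed before
    [q], which requires potentials whose contraction factor and range are bounded independently of
    [q]. The dimension enters only prefactors, because the box average acts along each axis as a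
    mixture of window averages.

    At r = 1 the lower bound r / 2 given by the piecewise linear potential meets the upper bound r /
    2 given by the coordinate. For r < 1 only positivity of the lower bound matters, so a crude
    contraction factor suffices there. *)

Section Spectrum.
Variable R : realType.
Implicit Types n : nat.

Lemma mup_prod_XsubC n (a : 'I_n -> R) x :
  mup x (\prod_i ('X - (a i)%:P)) = count_mem x [seq a i | i <- enum 'I_n].
Proof.
rewrite -big_enum; elim: (enum 'I_n) => [|i s IHs] /=.
  by rewrite big_nil mupNroot // root1.
rewrite big_cons mupM ?polyXsubC_eq0 //; last first.
  by apply/eqP => /(congr1 (@lead_coef _))/eqP; rewrite lead_coef_prod_XsubC lead_coef0 oner_eq0.
by rewrite -['X - _]expr1 mup_XsubCX IHs eq_sym; case: eqP.
Qed.

Lemma count_eigenvalues n (M : 'M[R]_n) x :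
  count_mem x (eigenvalues M) = mup x (char_poly M).
Proof.
have p0 : char_poly M != 0 by rewrite monic_neq0 ?char_poly_monic.
rewrite /eigenvalues; set p := char_poly M in p0 *.
(* The membership factor makes the claim provable by induction along the list of roots. *)
have <- : (mup x p * (x \in polyrcf.rootsR p))%N = mup x p.
  rewrite -(polyrcf.roots_on_rootsR p0) inE.
  by case: (boolP (root p x)) => [|/mupNroot->]; rewrite ?muln1.
have := polyrcf.sorted_roots (- polyrcf.cauchy_bound p) (polyrcf.cauchy_bound p) p.
move/(sorted_uniq lt_trans (@ltxx _ _)); rewrite -/(polyrcf.rootsR p); elim: (polyrcf.rootsR p) => [|y s IHs] /=.
  by rewrite muln0.
case/andP => ys us; rewrite count_cat IHs // count_nseq /= inE.
have [<-|yx] := eqVneq y x.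
  by rewrite (negPf ys) muln0 addn0 mul1n muln1.
by rewrite mul0n.
Qed.

Lemma sorted_eigenvalues n (M : 'M[R]_n) : sorted <=%R (eigenvalues M).
Proof.
rewrite /eigenvalues; set p := char_poly M.
have := polyrcf.sorted_roots (- polyrcf.cauchy_bound p) (polyrcf.cauchy_bound p) p.
rewrite -/(polyrcf.rootsR p); elim: (polyrcf.rootsR p) => [|y s IHs] //= ys.
have ss := path_sorted ys.
rewrite sorted_pairwise; last exact: le_trans.
rewrite pairwise_cat -sorted_pairwise; last exact: le_trans.
rewrite -sorted_pairwise; last exact: le_trans.
rewrite IHs // andbT; apply/andP; split.
  apply/allrelP => u v; rewrite mem_nseq => /andP[_ /eqP->].
  case/flatten_mapP => z zs; rewrite mem_nseq => /andP[_ /eqP->].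
  by apply: ltW; apply: (allP (order_path_min lt_trans ys)).
by elim: (mup y p) => [|[|k] IHk] //=; rewrite lexx.
Qed.
End Spectrum.

Section SymmetricSpectrum.
Import complex.
Variables (R : realType) (n : nat) (S : 'M[R]_n).
Hypothesis symS : S^T = S.
Local Notation C := (R[i]).
Local Notation toC := (map_mx (real_complex R)).
Local Open Scope sesquilinear_scope.

(* The rows of [U] are a unitary eigenbasis; it is taken over [R[i]] since
   [spectral] is stated over closed fields. *)
Lemma symmetric_unitary_diag :
  exists U : 'M[C]_n, exists a : 'I_n -> R,
    [/\ U \is unitarymx,
        U *m toC S = diag_mx (\row_i real_complex R (a i)) *m U
      & char_poly S = \prod_i ('X - (a i)%:P)].
Proof.
have SR : toC S \is a realmx.
  by apply/mxOverP => i j; rewrite mxE complex_real.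
have SS : toC S \is symmetricmx.
  by apply/is_hermitianmxP; rewrite /= expr0 scale1r map_mx_id // map_trmx symS.
have herm := realsym_hermsym SS SR.
have Unit := spectral_unitarymx (toC S).
have /orthomx_spectralP := hermitian_normalmx herm.
have /mxOverP Dreal := hermitian_spectral_diag_real herm.
set U := spectralmx _ in Unit *; set D := spectral_diag _ in Dreal * => SE.
have Uu := unitarymx_unit Unit.
pose a i := complex.Re (D 0 i).
have DE : D = \row_i real_complex R (a i).
  by apply/rowP => i; rewrite mxE /a RRe_real.
exists U, a; split; [exact: Unit|by rewrite -DE SE -mulmxA mulKVmx|].
apply: (map_poly_inj (real_complex R)).
rewrite map_char_poly SE rmorph_prod /=.
have -> : char_poly (invmx U *m diag_mx D *m U) = char_poly (diag_mx D).
  rewrite /char_poly /char_poly_mx !map_mxM /=.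
  rewrite [in LHS](_ : 'X%:M =
      map_mx polyC (invmx U) *m 'X%:M *m map_mx polyC U :> 'M[_]_n); last first.
    by rewrite scalar_mxC -mulmxA -map_mxM mulVmx // map_mx1 mulmx1.
  rewrite -mulmxBl -mulmxBr !det_mulmx mulrAC -det_mulmx -map_mxM mulVmx //.
  by rewrite map_mx1 det1 mul1r.
rewrite char_poly_trig ?diag_mx_is_trig //; apply: eq_bigr => i _.
by rewrite mxE eqxx mulr1n rmorphB /= map_polyX map_polyC /= DE mxE.
Qed.

(** The spectral theorem yields the eigenvalues [a] in no particular order. Here [i1] and [i2] are
    indices sitting at positions 0 and 1 of the sorted list, so every index other than [i1] sits at
    position 1 or later. *)
Lemma second_eigenvalueP (a : 'I_n -> R) : (1 < n)%N ->
  char_poly S = \prod_i ('X - (a i)%:P) ->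
  exists i1 i2, [/\ i1 != i2, a i1 <= a i2, a i2 = nth 0 (eigenvalues S) 1
    & forall i, i != i1 -> a i2 <= a i].
Proof.
move=> n1 pS; set s := eigenvalues S.
have ps : perm_eq s [seq a i | i <- enum 'I_n].
  by apply/allP => x _ /=; rewrite count_eigenvalues pS mup_prod_XsubC.
have [Is pIs sE] := perm_iotaP 0 ps.
have sz : size [seq a i | i <- enum 'I_n] = n by rewrite size_map size_enum_ord.
have szI : size Is = n by rewrite (perm_size pIs) size_iota sz.
have lt_Is j : (nth 0 Is j < n)%N.
  have [jn|jn] := ltnP j n; last by rewrite nth_default ?szI // (leq_trans _ n1).
  have : nth 0 Is j \in Is by rewrite mem_nth ?szI.
  by rewrite (perm_mem pIs) mem_iota sz.
pose i_ j := Ordinal (lt_Is j).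
have nth_s j : (j < n)%N -> nth 0 s j = a (i_ j).
  move=> jn; rewrite sE (nth_map 0%N) ?szI // (nth_map (i_ j)) ?size_enum_ord //.
  by congr a; apply: val_inj; rewrite /= nth_enum_ord.
have uI : uniq Is by rewrite (perm_uniq pIs) iota_uniq.
have les j k : (j <= k)%N -> (k < n)%N -> a (i_ j) <= a (i_ k).
  move=> jk kn; rewrite -!nth_s ?(leq_ltn_trans jk) //.
  apply: (sorted_leq_nth le_trans lexx 0 (sorted_eigenvalues S)) => //;
  by rewrite inE -/s sE size_map szI // (leq_ltn_trans jk).
exists (i_ 0), (i_ 1); split.
- apply/eqP => /(congr1 val) /= /eqP; rewrite nth_uniq ?szI //; exact: ltnW.
- exact: les.
- by rewrite nth_s.
move=> i ii0.
have : val i \in Is by rewrite (perm_mem pIs) mem_iota sz /=.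
case/(nthP 0) => j; rewrite szI => jn ji.
have iE : i = i_ j by apply: val_inj.
rewrite iE; apply: les => //; case: j jn ji iE => // _ _ iE.
by rewrite iE eqxx in ii0.
Qed.

(** [F] stands for the real or the imaginary part; being linear over the reals, it commutes with
    multiplication by a real matrix. *)
Lemma real_kernel_vector (F : R[i] -> R) (g : 'rV[C]_n) p (B : 'M[R]_(n, p)) :
  {morph F : x y / x + y} -> F 0 = 0 -> (forall x y, F (x * y%:C%C) = F x * y) ->
  g *m toC B = 0 -> map_mx F g *m B = 0.
Proof.
move=> FD F0 FM /matrixP gB; apply/matrixP => i j.
have := congr1 F (gB i j); rewrite !mxE F0 (big_morph F FD F0); apply: etrans.
by apply: eq_bigr => k _; rewrite !mxE FM.
Qed.

Lemma real_kernel_neq0 (g : 'rV[C]_n) p (B : 'M[R]_(n, p)) :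
  g != 0 -> g *m toC B = 0 -> exists2 f : 'rV[R]_n, f != 0 & f *m B = 0.
Proof.
move=> g0 gB.
have [re0|re0] := eqVneq (map_mx (@complex.Re R) g) 0; last first.
  exists (map_mx (@complex.Re R) g) => //.
  by apply: real_kernel_vector gB => // [[? ?] [? ?]|[a b] y]; rewrite //= mulr0 subr0.
exists (map_mx (@complex.Im R) g).
  apply: contra_neq g0 => im0; apply/rowP => j.
  have /rowP/(_ j) := re0; have /rowP/(_ j) := im0; rewrite !mxE.
  by case: (g 0 j) => a b /= -> ->.
by apply: real_kernel_vector gB => // [[? ?] [? ?]|[a b] y]; rewrite //= mulr0 add0r.
Qed.

Variable v : 'rV[R]_n.
Hypotheses (n1 : (1 < n)%N) (v0 : v != 0) (vS : v *m S = 0).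
Hypothesis posS : forall f : 'rV[R]_n, 0 <= (f *m S *m f^T) 0 0.
Local Notation gamma := (nth 0 (eigenvalues S) 1).

Lemma rV_sqr_gt0 (f : 'rV[R]_n) : f != 0 -> 0 < (f *m f^T) 0 0.
Proof.
move=> f0; rewrite mxE lt0r sumr_ge0 ?andbT; last first.
  by move=> i _; rewrite mxE -expr2 sqr_ge0.
apply: contra_neq f0 => /eqP.
rewrite psumr_eq0 => [/allP f0|i _]; last by rewrite mxE -expr2 sqr_ge0.
apply/rowP => j; have := f0 j (mem_index_enum _).
by rewrite mxE -expr2 sqrf_eq0 mxE => /eqP.
Qed.

(** If [gamma] is nonzero, row [i2] of the eigenbasis is orthogonal to the kernel vector [v] by
    symmetry of [S]. If [gamma] is zero, positivity forces [a i1 = 0] as well, and the plane spanned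
    by rows [i1] and [i2] lies in the kernel and contains a nonzero vector orthogonal to [v]. *)
Lemma second_eigenvector :
  exists f : 'rV[R]_n, [/\ f != 0, f *m S = gamma *: f & f *m v^T = 0].
Proof.
have [U [a [Uu US pS]]] := symmetric_unitary_diag.
have [i1 [i2 [i12 a12 aE age]]] := second_eigenvalueP n1 pS.
have rowU i : row i U *m toC S = (a i)%:C%C *: row i U.
  by rewrite -row_mul US; apply/rowP => j; rewrite mul_diag_mx !mxE.
have Ufree : row_free U by rewrite row_free_unit unitarymx_unit.
have comb0 (x y : C) : x *: row i1 U + y *: row i2 U = 0 -> (x == 0) && (y == 0).
  rewrite !rowE !scalemxAl -mulmxDl => /(congr1 (mulmx^~ (invmx U))).
  rewrite mulmxK ?unitarymx_unit // mul0mx => /rowP E.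
  have := E i1; have := E i2; rewrite !mxE !eqxx /= (negPf i12) eq_sym (negPf i12).
  by rewrite !mulr0 !mulr1 addr0 add0r => -> ->; rewrite eqxx.
suff [g [g0 gS gv]] : exists g : 'rV[C]_n, [/\ g != 0, g *m toC S = gamma%:C%C *: g
    & g *m toC v^T = 0].
  (* The eigenvalue equation and the orthogonality are one kernel equation for a block matrix, so
     that the same real or imaginary part satisfies both. *)
  have [|f f0] := @real_kernel_neq0 g _ (row_mx (S - gamma%:M) v^T) g0.
    rewrite map_row_mx mul_mx_row gv map_mxB map_scalar_mx mulmxBr gS mul_mx_scalar.
    by rewrite subrr row_mx0.
  rewrite mul_mx_row -row_mx0 => /eq_row_mx[fS fv]; exists f; split=> //.
  by apply/eqP; rewrite -subr_eq0 -mul_mx_scalar -mulmxBr fS.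
have vS' : toC S *m toC v^T = 0.
  by rewrite -map_mxM -{1}symS -trmx_mul vS trmx0 map_mx0.
have [g0|g0] := eqVneq gamma 0; last first.
  exists (row i2 U); split; last 2 first.
  - by rewrite rowU aE.
  - apply/eqP; have /eqP := congr1 (mulmx^~ (toC v^T)) (rowU i2).
    rewrite -mulmxA vS' mulmx0 aE -scalemxAl eq_sym scaler_eq0 => /orP[|//].
    by move=> /eqP[] /eqP; rewrite (negPf g0).
  apply/eqP => u0; have := comb0 0 1.
  by rewrite scale0r scale1r add0r oner_eq0 andbF => /(_ u0).
have a1 : a i1 = 0.
  apply/eqP; rewrite eq_le -{1}g0 -aE a12 /=.
  have /eigenvalueP[f fS f0] : eigenvalue S (a i1).
    rewrite eigenvalue_root_char pS /root horner_prod.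
    by apply/prodf_eq0; exists i1; rewrite // hornerXsubC subrr.
  have := posS f; rewrite fS -scalemxAl mxE pmulr_lge0 //; exact: rV_sqr_gt0.
have kerC (x y : C) : (x *: row i1 U + y *: row i2 U) *m toC S = 
    gamma%:C%C *: (x *: row i1 U + y *: row i2 U).
  rewrite mulmxDl -!scalemxAl !rowU a1 aE g0; have -> : 0%:C%C = 0 :> C by [].
  by rewrite !scale0r !scaler0 addr0.
pose p i := (row i U *m toC v^T) 0 0.
have pE i : row i U *m toC v^T = (p i)%:M by rewrite [LHS]mx11_scalar.
have [p1|p1] := eqVneq (p i1) 0.
  exists (1 *: row i1 U + 0 *: row i2 U); split => //.
    by apply/eqP => /comb0; rewrite oner_eq0.
  by rewrite scale1r scale0r addr0 pE p1 raddf0.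
exists (p i2 *: row i1 U + (- p i1) *: row i2 U); split => //.
  by apply/eqP => /comb0; rewrite oppr_eq0 (negPf p1) andbF.
rewrite mulmxDl -!scalemxAl !pE -!mul_scalar_mx -!scalar_mxM -raddfD /=.
by rewrite mulNr mulrC subrr raddf0.
Qed.

Lemma gamma_ge0 : 0 <= gamma.
Proof.
have [f [f0 fS _]] := second_eigenvector.
by have := posS f; rewrite fS -scalemxAl mxE pmulr_lge0 // rV_sqr_gt0.
Qed.

(** The variational bound of Courant and Fischer. For [gamma > 0] the eigenvalues off [i1] are
    positive, so [v] has its only nonzero coordinate at [i1]; orthogonality to [v] then kills that
    coordinate of [f], and the remaining eigenvalues are at least [gamma]. *)
Lemma second_eigenvalue_le (f : 'rV[R]_n) :
  f *m v^T = 0 -> gamma * (f *m f^T) 0 0 <= (f *m S *m f^T) 0 0.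
Proof.
move=> fv; have := gamma_ge0; rewrite le_eqVlt => /orP[/eqP<-|g0].
  by rewrite mul0r.
have [U [a [Uu US pS]]] := symmetric_unitary_diag.
have [i1 [i2 [i12 a12 aE age]]] := second_eigenvalueP n1 pS.
have /unitarymxP UU := Uu.
have UV : U ^t* *m U = 1%:M by apply: mulmx1C.
have SE : toC S = U ^t* *m diag_mx (\row_i (a i)%:C%C) *m U.
  by rewrite -mulmxA -US mulmxA UV mul1mx.
pose y (x : 'rV[R]_n) : 'rV[C]_n := toC x *m U ^t*.
have yt (x : 'rV[R]_n) : U *m toC x^T = (y x) ^t*.
  rewrite trmx_mul map_mxM trmxCK; congr (_ *m _).
  by apply/matrixP => i j; rewrite !mxE; apply/esym/CrealP; rewrite complex_real.
have dotE (x z : 'rV[R]_n) : ((x *m z^T) 0 0)%:C%C = \sum_i y x 0 i * (y z 0 i)^*.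
  transitivity ((toC (x *m z^T)) 0 0); first by rewrite [RHS]mxE.
  rewrite map_mxM -[toC x]mulmx1 -UV mulmxA -mulmxA yt mxE.
  by apply: eq_bigr => i _; congr (_ * _); rewrite [LHS]mxE; congr (_^*); rewrite [LHS]mxE.
have dotSE (x : 'rV[R]_n) : ((x *m S *m x^T) 0 0)%:C%C = \sum_i (a i)%:C%C * `|y x 0 i|^+2.
  transitivity ((toC (x *m S *m x^T)) 0 0); first by rewrite [RHS]mxE.
  rewrite !map_mxM SE !mulmxA -/(y x) -mulmxA yt mxE.
  by apply: eq_bigr => i _; rewrite mul_mx_diag !mxE mulrAC mulrC normCK.
have yv i : i != i1 -> y v 0 i = 0.
  move=> ii1; have /rowP/(_ i) : y v *m diag_mx (\row_i (a i)%:C%C) = 0.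
    rewrite -[LHS]mulmx1 -UU mulmxA /y -[_ *m U ^t* *m _]mulmxA.
    by rewrite -[_ *m _ *m U]mulmxA -SE -map_mxM vS map_mx0 mul0mx.
  rewrite mul_mx_diag !mxE => /eqP; rewrite mulf_eq0 => /orP[/eqP//|].
  move=> /eqP[] ai0; have := age i ii1; rewrite ai0 aE => /le_lt_trans/(_ g0).
  by rewrite ltxx.
have yv1 : y v 0 i1 != 0.
  apply: contraTneq (rV_sqr_gt0 v0) => yv1; rewrite -leNgt -lecR dotE.
  rewrite big1 // => i _; have [->|/yv->] := eqVneq i i1; by rewrite ?yv1 mul0r.
have yf1 : y f 0 i1 = 0.
  have := dotE f v; rewrite fv mxE (bigD1 i1) //= big1 => [/eqP|i /yv->]; last first.
    by rewrite conjC0 mulr0.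
  by rewrite addr0 eq_sym mulf_eq0 conjC_eq0 (negPf yv1) orbF => /eqP.
rewrite -lecR rmorphM /= dotE dotSE mulr_sumr; apply: ler_sum => i _.
have [->|ii1] := eqVneq i i1; first by rewrite yf1 normr0 expr0n mul0r !mulr0.
by rewrite -normCK ler_wpM2r ?exprn_ge0 // lecR -aE age.
Qed.
End SymmetricSpectrum.

(** * The normalized Laplacian as a weighted random walk *)

Section NormalizedLaplacian.
Variables (R : realType) (n : nat) (W : 'M[R]_n).
Local Notation deg i := (\sum_j W i j).
Hypotheses (n1 : (1 < n)%N) (symW : forall i j, W i j = W j i).
Hypotheses (W0 : forall i j, 0 <= W i j) (deg0 : forall i, 0 < deg i).
Let s i := Num.sqrt (deg i).
Let D : 'M[R]_n := diag_mx (\row_i (s i)^-1).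
Let L := 1%:M - D *m W *m D.
Local Notation gamma := (nth 0 (eigenvalues L) 1).

Let s0 i : s i != 0. Proof. by rewrite sqrtr_eq0 -ltNge deg0. Qed.
Let ss i : s i * s i = deg i. Proof. by rewrite -expr2 sqr_sqrtr // ltW. Qed.

Let LE i j : L i j = (i == j)%:R - (s i)^-1 * W i j * (s j)^-1.
Proof. by rewrite /L mul_mx_diag mul_diag_mx !mxE. Qed.

(** The substitution by the square root of the degree matrix turns [L] into the identity minus the
    random walk, and the standard inner product into the one weighted by degrees. The constant
    function becomes the kernel vector [v]. *)
Let row_of (f : 'I_n -> R) : 'rV[R]_n := \row_i (s i * f i).

Let row_ofL f j : (row_of f *m L) 0 j = s j * f j - (s j)^-1 * \sum_i W j i * f i.
Proof.
rewrite mxE (eq_bigr (fun i => (i == j)%:R * (s i * f i) - (s j)^-1 * (W j i * f i))).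
  rewrite sumrB -mulr_sumr (bigD1 j) //= eqxx mul1r big1 ?addr0 // => i /negPf->.
  by rewrite mul0r.
move=> i _; rewrite mxE LE mulrBr mulrC symW; congr (_ - _).
by field; rewrite !s0.
Qed.

Let dot_row_of f g : (row_of f *m (row_of g)^T) 0 0 = \sum_i deg i * f i * g i.
Proof. by rewrite mxE; apply: eq_bigr => i _; rewrite !mxE mulrACA ss mulrA. Qed.

Let form_row_of f : (row_of f *m L *m (row_of f)^T) 0 0 =
  \sum_i deg i * f i ^+ 2 - \sum_i f i * \sum_j W i j * f j.
Proof.
rewrite mxE -sumrB; apply: eq_bigr => i _; rewrite row_ofL !mxE -ss.
by field; rewrite s0.
Qed.

Let row_ofE (g : 'rV[R]_n) : row_of (fun i => (s i)^-1 * g 0 i) = g.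
Proof. by apply/rowP => i; rewrite mxE mulrA mulfV // mul1r. Qed.

Let form_ge0 f :
  0 <= \sum_i deg i * f i ^+ 2 - \sum_i f i * \sum_j W i j * f j.
Proof.
(* The Dirichlet form of the weighted graph, manifestly nonnegative. *)
have -> : \sum_i deg i * f i ^+ 2 - \sum_i f i * \sum_j W i j * f j =
    2^-1 * \sum_i \sum_j W i j * (f i - f j) ^+ 2.
  have E1 : \sum_i \sum_j W i j * (f i - f j) ^+ 2 =
    \sum_i \sum_j W i j * f i ^+ 2 + \sum_i \sum_j W i j * f j ^+ 2
    - 2 * \sum_i f i * \sum_j W i j * f j.
    rewrite mulr_sumr -big_split -sumrB; apply: eq_bigr => i _ /=.
    rewrite !mulr_sumr -big_split -sumrB; apply: eq_bigr => j _ /=.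
    by rewrite sqrrB; ring.
  have E2 : \sum_i \sum_j W i j * f j ^+ 2 = \sum_i deg i * f i ^+ 2.
    rewrite exchange_big; apply: eq_bigr => i _; rewrite mulr_suml.
    by apply: eq_bigr => j _; rewrite symW.
  have E3 : \sum_i \sum_j W i j * f i ^+ 2 = \sum_i deg i * f i ^+ 2.
    by apply: eq_bigr => i _; rewrite mulr_suml.
  by rewrite E1 E2 E3; field.
rewrite mulr_ge0 ?invr_ge0 // sumr_ge0 // => i _; rewrite sumr_ge0 // => j _.
by rewrite mulr_ge0 ?sqr_ge0.
Qed.

Let symL : L^T = L.
Proof.
apply/matrixP => i j; rewrite mxE !LE eq_sym symW; congr (_ - _).
by rewrite mulrC mulrA mulrAC.
Qed.

Let v := row_of (fun=> 1).

Let v0 : v != 0.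
Proof.
apply/eqP => /rowP/(_ (Ordinal (ltnW n1))); rewrite !mxE mulr1 => /eqP.
by rewrite (negPf (s0 _)).
Qed.

Let vL : v *m L = 0.
Proof.
apply/rowP => j; rewrite row_ofL mulr1 mxE.
under eq_bigr do rewrite mulr1.
by rewrite -ss mulrA mulVf // mul1r subrr.
Qed.

Let posL (g : 'rV[R]_n) : 0 <= (g *m L *m g^T) 0 0.
Proof. by rewrite -[g]row_ofE form_row_of form_ge0. Qed.

Lemma laplacian_gap_ge0 : 0 <= gamma.
Proof. exact: (gamma_ge0 symL n1 vL posL). Qed.

Lemma laplacian_gap_eigenfunction : exists f : 'I_n -> R,
  [/\ exists i, f i != 0,
      forall i, \sum_j W i j * f j = (1 - gamma) * deg i * f i
    & \sum_i deg i * f i = 0].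
Proof.
have [g [g0 gL gv]] := second_eigenvector symL n1 vL posL.
exists (fun i => (s i)^-1 * g 0 i); split.
- have [i gi] : exists i, g 0 i != 0.
    by apply/existsP; apply: contraNT g0 => /existsPn g0; apply/eqP/rowP => i;
      rewrite mxE; apply/eqP/negbNE/g0.
  by exists i; rewrite mulf_neq0 ?invr_eq0.
- move=> i; have := row_ofL (fun i => (s i)^-1 * g 0 i) i.
  rewrite row_ofE gL mxE; set z := \sum_j _ => E.
  have -> : z = s i * (g 0 i - gamma * g 0 i) by rewrite E; field; rewrite s0.
  by rewrite -ss; field; rewrite s0.
have /(congr1 (fun A : 'M[R]_1 => A 0 0)) := gv; rewrite -{1}[g]row_ofE dot_row_of mxE.
by apply: etrans; apply: eq_bigr => i _; rewrite mulr1.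
Qed.

Lemma laplacian_gap_le f : \sum_i deg i * f i = 0 ->
  gamma * \sum_i deg i * f i ^+ 2 <=
  \sum_i deg i * f i ^+ 2 - \sum_i f i * \sum_j W i j * f j.
Proof.
move=> df0; have fv : row_of f *m v^T = 0.
  apply/matrixP => i j; rewrite !ord1 dot_row_of mxE -[RHS]df0.
  by apply: eq_bigr => k _; rewrite mulr1.
have := second_eigenvalue_le symL n1 v0 vL posL fv.
rewrite form_row_of dot_row_of.
by under eq_bigr do rewrite -mulrA -expr2.
Qed.

(** For test functions that are not exactly centred. Subtracting the weighted mean lowers both
    [\sum_i deg i * f i ^+ 2] and the walk form by the same [bias], so their difference is
    unchanged. *)
Lemma laplacian_gap_variance f :
  let mass := \sum_i deg i in
  let bias := (\sum_i deg i * f i) ^+ 2 / mass in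
  0 <= \sum_i deg i * f i ^+ 2 - bias /\
  gamma * (\sum_i deg i * f i ^+ 2 - bias) <=
  \sum_i deg i * f i ^+ 2 - \sum_i f i * \sum_j W i j * f j.
Proof.
set m := \sum_i deg i; set s1 := \sum_i deg i * f i => /=.
have m0 : 0 < m.
  rewrite /m (bigD1 (Ordinal (ltnW n1))) //= ltr_wpDr ?deg0 // sumr_ge0 // => i _.
  exact: ltW.
set b := \sum_i _ * _ ^+ 2; set a := \sum_i f i * _.
pose x := s1 / m; pose f' i := f i - x.
have mE : m * x = s1 by rewrite mulrC divfK // lt0r_neq0.
have z : \sum_i deg i * f' i = 0.
  rewrite (eq_bigr (fun i => deg i * f i - deg i * x)) => [|i _]; last by rewrite mulrBr.
  by rewrite sumrB -mulr_suml -/m mE subrr.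
have bE : \sum_i deg i * f' i ^+ 2 = b - s1 ^+ 2 / m.
  rewrite (eq_bigr (fun i => deg i * f i ^+ 2 - (2 * x) * (deg i * f i) + deg i * x ^+ 2)).
    rewrite big_split sumrB /= -mulr_sumr -mulr_suml -/m -/s1 -/b /x; field.
    exact: lt0r_neq0.
  by move=> i _; rewrite /f'; ring.
have aE : \sum_i f' i * \sum_j W i j * f' j = a - s1 ^+ 2 / m.
  rewrite (eq_bigr (fun i => f i * (\sum_j W i j * f j) - x * (\sum_j W i j * f j)
      - x * (deg i * f i) + x ^+ 2 * deg i)) => [|i _]; last first.
    rewrite /f'; under eq_bigr do rewrite mulrBr.
    rewrite sumrB -mulr_suml; ring.
  rewrite big_split !sumrB /= -!mulr_sumr -/a -/s1 -/m.
  have -> : \sum_i \sum_j W i j * f j = s1.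
    rewrite exchange_big; apply: eq_bigr => j _; rewrite mulr_suml.
    by apply: eq_bigr => i _; rewrite symW.
  by rewrite -mE; field; exact: lt0r_neq0.
split; first by rewrite -bE sumr_ge0 // => i _; rewrite mulr_ge0 ?sqr_ge0 // ltW.
by have := laplacian_gap_le z; rewrite bE aE opprD opprK addrACA addNr addr0.
Qed.
End NormalizedLaplacian.

(** * Window averages on an interval *)

Section IntervalAverage.
Variable R : realFieldType.
Implicit Types (g : nat -> R) (a b : nat).

Definition avg g a b : R := (\sum_(a <= k < b) g k) / (b - a)%:R.

Lemma avgD f g a b : avg (fun k => f k + g k) a b = avg f a b + avg g a b.
Proof. by rewrite /avg big_split mulrDl. Qed.

Lemma avgZ x g a b : avg (fun k => x * g k) a b = x * avg g a b.
Proof. by rewrite /avg -mulr_sumr mulrA. Qed.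

Lemma avgB f g a b : avg (fun k => f k - g k) a b = avg f a b - avg g a b.
Proof. by rewrite /avg sumrB mulrBl. Qed.

Lemma avg_const x a b : (a < b)%N -> avg (fun=> x) a b = x.
Proof.
move=> ab; rewrite /avg sumr_const_nat -[x *+ _]mulr_natr mulfK //.
by rewrite pnatr_eq0 subn_eq0 -ltnNge.
Qed.

Lemma ler_avg f g a b : (forall k, (a <= k < b)%N -> f k <= g k) ->
  avg f a b <= avg g a b.
Proof. by move=> fg; rewrite ler_wpM2r ?invr_ge0 ?ler0n // ler_sum_nat. Qed.

Lemma avg_le x g a b : (a < b)%N -> (forall k, (a <= k < b)%N -> g k <= x) ->
  avg g a b <= x.
Proof. by move=> ab gx; rewrite -[leRHS](avg_const _ ab); exact: ler_avg. Qed.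

Lemma avg_ge x g a b : (a < b)%N -> (forall k, (a <= k < b)%N -> x <= g k) ->
  x <= avg g a b.
Proof. by move=> ab gx; rewrite -[leLHS](avg_const _ ab); exact: ler_avg. Qed.

Lemma norm_avg_le x g a b : (a < b)%N ->
  (forall k, (a <= k < b)%N -> `|g k| <= x) -> `|avg g a b| <= x.
Proof.
move=> ab gx; rewrite ler_norml avg_le ?avg_ge // => k kab;
by have := gx k kab; rewrite ler_norml => /andP[].
Qed.

Lemma avg_recr g a b : (a < b)%N ->
  avg g a b.+1 - avg g a b = (g b - avg g a b) / (b.+1 - a)%:R.
Proof.
move=> ab; rewrite /avg big_nat_recr ?(ltnW ab) //= subSn ?(ltnW ab) // -natr1.
have : (b - a)%:R != 0 :> R by rewrite pnatr_eq0 subn_eq0 -ltnNge.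
have : (b - a)%:R + 1 != 0 :> R by rewrite natr1 pnatr_eq0.
by move=> n0 n1; field; rewrite n0 n1.
Qed.

Lemma avg_recl g a b : (a < b)%N ->
  avg g a.+1 b.+1 - avg g a b.+1 = (avg g a.+1 b.+1 - g a) / (b.+1 - a)%:R.
Proof.
move=> ab; rewrite /avg [in X in _ - X]big_ltn ?ltnS ?(ltnW ab) // subSS subSn ?(ltnW ab) // -natr1.
have : (b - a)%:R != 0 :> R by rewrite pnatr_eq0 subn_eq0 -ltnNge.
have : (b - a)%:R + 1 != 0 :> R by rewrite natr1 pnatr_eq0.
by move=> n0 n1; field; rewrite n0 n1.
Qed.
End IntervalAverage.

Section WindowAverage.
Variables (R : realFieldType) (N M : nat).
Hypotheses (M0 : (0 < M)%N) (MN : (M <= N)%N).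
Implicit Types g W : nat -> R.

Definition winl i := (i - M)%N.
Definition winr i := minn N (i + M).+1.
Definition win_avg g i := avg g (winl i) (winr i).

Lemma win_size i : (i < N)%N -> (winl i + M <= winr i)%N.
Proof. by rewrite /winl /winr; lia. Qed.

Lemma win_lt i : (i < N)%N -> (winl i < winr i)%N.
Proof. by rewrite /winl /winr; lia. Qed.

(* The window at [i.+1] is reached from the one at [i] by first appending a
   point on the right, then deleting one on the left. *)
Lemma win_stepP i (P : nat -> nat -> Prop) : (i.+1 < N)%N ->
  P (winl i) (winr i) ->
  (winr i = (i + M).+1 -> winr i.+1 = (winr i).+1 ->
    P (winl i) (winr i) -> P (winl i) (winr i).+1) ->
  (winl i = (i - M)%N -> (M <= i)%N -> winl i.+1 = (winl i).+1 ->
    P (winl i) (winr i.+1) -> P (winl i).+1 (winr i.+1)) ->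
  P (winl i.+1) (winr i.+1).
Proof.
move=> iN P0 Pr Pl.
have Pr' : P (winl i) (winr i.+1).
  have [h|h] : winr i.+1 = winr i \/ (winr i = (i + M).+1 /\ winr i.+1 = (winr i).+1).
    by rewrite /winr; lia.
  - by rewrite h.
  - by case: h => h1 h2; rewrite h2; exact: Pr.
have [h|[h1 h2]] : winl i.+1 = winl i \/ ((M <= i)%N /\ winl i.+1 = (winl i).+1).
  by rewrite /winl; lia.
- by rewrite h.
- by rewrite h2; exact: Pl.
Qed.

Lemma win_avg_mono g i :
  (forall j, (j.+1 < N)%N -> g j <= g j.+1) ->
  (i.+1 < N)%N -> win_avg g i <= win_avg g i.+1.
Proof.
move=> gm iN; have gle j k : (j <= k)%N -> (k < N)%N -> g j <= g k.
  move=> /subnK<-; elim: (k - j)%N => [//|n IHn] nN.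
  by rewrite (le_trans (IHn _)) ?gm // ltnW.
have wi := win_lt (ltnW iN); have wi1 := win_lt iN.
rewrite /win_avg; apply: (@win_stepP i (fun a b => _ <= avg g a b)) => //.
- move=> _ rE /le_trans; apply; rewrite -subr_ge0 avg_recr // divr_ge0 // subr_ge0.
  apply: avg_le => // k /andP[_ kr]; apply: gle; first exact: ltnW.
  by have := geq_minl N (i.+1 + M).+1; rewrite -/(winr _) rE.
- move=> _ _ lE /le_trans; apply; move: wi1; rewrite lE.
  case E : (winr i.+1) => [//|b] wi1; rewrite -subr_ge0 avg_recl // divr_ge0 // subr_ge0.
  apply: avg_ge => // k /andP[lk kr]; apply: gle; first exact: ltnW.
  by apply: leq_trans kr _; rewrite -E geq_minl.
Qed.

(** At most one point is appended and one deleted. Since all windows have at least [M] points, each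
    change moves the average by at most [2 * B / M]. *)
Lemma win_avg_smooth g B i : (forall k, (k < N)%N -> `|g k| <= B) ->
  (i.+1 < N)%N -> `|win_avg g i.+1 - win_avg g i| <= 4 * B / M%:R.
Proof.
move=> gB iN; have B0 : 0 <= B by rewrite (le_trans _ (gB i (ltnW iN))).
have wi := win_lt (ltnW iN); have wi1 := win_lt iN.
have si := win_size (ltnW iN); have si1 := win_size iN.
have rN j : (winr j <= N)%N by rewrite geq_minl.
have step a b x : (a + M < b)%N -> `|x| <= 2 * B -> `|x / (b - a)%:R| <= 2 * B / M%:R.
  move=> ab xB; rewrite normrM normfV normr_nat ler_pM ?invr_ge0 //.
  rewrite lef_pV2 ?posrE ?ltr0n ?ler_nat //; lia.
have avgB a b : (a < b)%N -> (b <= N)%N -> `|avg g a b| <= B.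
  by move=> ab bN; apply: norm_avg_le => // k /andP[_ /leq_trans kb]; rewrite gB ?kb.
have C : `|avg g (winl i) (winr i.+1) - win_avg g i| <= 2 * B / M%:R.
  have [->|rE] : winr i.+1 = winr i \/ winr i.+1 = (winr i).+1 by rewrite /winr; lia.
    by rewrite subrr normr0 divr_ge0 ?mulr_ge0.
  rewrite rE avg_recr //; apply: step; first by rewrite ltnS.
  rewrite (le_trans (ler_normB _ _)) // mulr_natl mulr2n lerD ?avgB //.
  by rewrite gB // -rE.
have D : `|win_avg g i.+1 - avg g (winl i) (winr i.+1)| <= 2 * B / M%:R.
  have [lE|lE] : winl i.+1 = winl i \/ winl i.+1 = (winl i).+1 by rewrite /winl; lia.
    by rewrite /win_avg lE subrr normr0 divr_ge0 ?mulr_ge0.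
  rewrite /win_avg lE; move: wi1 si1 (rN i.+1); rewrite lE.
  case: (winr i.+1) => [//|b] wi1 si1 bN; rewrite avg_recl //; apply: step => //.
  rewrite (le_trans (ler_normB _ _)) // mulr_natl mulr2n lerD ?avgB //.
  by rewrite gB //; lia.
rewrite -(subrKA (avg g (winl i) (winr i.+1))) (le_trans (ler_normD _ _)) //.
by rewrite (le_trans (lerD D C)) // -mulrDl -mulrDl -natrD.
Qed.

(* A potential [W] turns the real line into a metric space in which the window
   averaging contracts Lipschitz constants by the factor [kappa]. *)
Record contracting_potential W (kappa B : R) := ContractingPotential {
  potential_mono : forall i, (i.+1 < N)%N -> W i <= W i.+1;
  potential_step : forall i, (i.+1 < N)%N ->
    (winl i.+1, winr i.+1) <> (winl i, winr i) -> N%:R^-1 <= W i.+1 - W i;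
  potential_range : W N.-1 - W 0%N <= B;
  potential_contract : forall i, (i.+1 < N)%N ->
    win_avg W i.+1 - win_avg W i <= kappa * (W i.+1 - W i) }.

Lemma win_avg_lipschitz W kappa B g L :
  contracting_potential W kappa B -> 0 <= L ->
  (forall i, (i.+1 < N)%N -> `|g i.+1 - g i| <= L * (W i.+1 - W i)) ->
  forall i, (i.+1 < N)%N ->
    `|win_avg g i.+1 - win_avg g i| <= kappa * L * (W i.+1 - W i).
Proof.
move=> [Wm _ _ Wc] L0 gL i iN.
(* The Lipschitz bound says exactly that [L * W + g] and [L * W - g] are nondecreasing, and
   averaging keeps them so. *)
have mD := @win_avg_mono (fun k => L * W k + g k) i.
have mB := @win_avg_mono (fun k => L * W k - g k) i.
rewrite /win_avg !avgD !avgZ in mD; rewrite /win_avg !avgB !avgZ in mB.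
have LW := ler_wpM2l L0 (Wc i iN); rewrite /win_avg in LW *.
have {}mD := mD _ iN; have {}mB := mB _ iN.
rewrite ler_norml; apply/andP; split.
- have : forall j, (j.+1 < N)%N -> L * W j + g j <= L * W j.+1 + g j.+1.
    by move=> j /gL; rewrite ler_norml => /andP[]; lra.
  by move/mD; lra.
- have : forall j, (j.+1 < N)%N -> L * W j - g j <= L * W j.+1 - g j.+1.
    by move=> j /gL; rewrite ler_norml => /andP[]; lra.
  by move/mB; lra.
Qed.
End WindowAverage.

(** * The two contracting potentials *)

Section Potentials.
Variables (R : realFieldType) (N M : nat).
Hypotheses (M0 : (0 < M)%N) (MN : (M <= N)%N).
Implicit Types W : nat -> R.

Lemma avg_rev (g : nat -> R) a :
  avg (fun k => g (N - k.+1)%N) a N = avg g 0 (N - a).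
Proof.
rewrite /avg subn0; congr (_ / _); rewrite big_nat_rev /=.
rewrite -{1}[a]add0n big_addn; apply: eq_big_nat => k kN; congr g; lia.
Qed.

(** Contraction only has to be checked for full windows and for windows cut off on the left: oddness
    carries the latter to the right end, and a window cut off on both sides does not move. *)
Lemma odd_contracting_potential W kappa B :
  (forall k, (k < N)%N -> W (N - k.+1)%N = - W k) ->
  (forall i, (i.+1 < N)%N -> W i <= W i.+1) ->
  (forall i, (i.+1 < N)%N -> ((i + M).+1 < N \/ M <= i)%N ->
    N%:R^-1 <= W i.+1 - W i) ->
  W N.-1 - W 0%N <= B -> 0 <= kappa ->
  (forall i, ((i + M).+1 < N)%N ->
    avg W 0 (i + M).+2 - avg W 0 (i + M).+1 <= kappa * (W i.+1 - W i)) ->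
  (forall i, (M <= i)%N -> ((i + M).+1 < N)%N ->
    avg W (i.+1 - M) (i + M).+2 - avg W (i - M) (i + M).+1 <= kappa * (W i.+1 - W i)) ->
  contracting_potential N M W kappa B.
Proof.
move=> Wodd Wm Ws Wr k0 WcE WcI; split=> // i iN.
  move=> neq; apply: Ws => //.
  have [h|h] := ltnP (i + M).+1 N; first by left.
  have [h'|h'] := leqP M i; first by right.
  by case: neq; rewrite /winl /winr; congr (_, _); lia.
have [h|h] := ltnP (i + M).+1 N; have [h'|h'] := leqP M i.
- have E1 : winr N M i.+1 = (i + M).+2 by rewrite /winr; lia.
  have E2 : winr N M i = (i + M).+1 by rewrite /winr; lia.
  by rewrite /win_avg E1 E2 WcI.
- have E1 : winr N M i.+1 = (i + M).+2 by rewrite /winr; lia.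
  have E2 : winr N M i = (i + M).+1 by rewrite /winr; lia.
  have E3 : winl M i.+1 = 0%N by rewrite /winl; lia.
  have E4 : winl M i = 0%N by rewrite /winl; lia.
  by rewrite /win_avg E1 E2 E3 E4 WcE.
(* Windows cut off on the right only: the reflection of the grid maps the step from [i] to [i.+1] to
   the step starting at [N - i.+2]. *)
- have E1 : winr N M i.+1 = N by rewrite /winr; lia.
  have E2 : winr N M i = N by rewrite /winr; lia.
  have odd_avg a : (a < N)%N -> avg W a N = - avg W 0 (N - a).
    move=> aN; rewrite -mulN1r -avgZ -avg_rev.
    rewrite /avg; congr (_ / _); apply: eq_big_nat => k /andP[_ kN].
    by rewrite mulN1r Wodd // opprK.
  have := WcE (N - i.+2)%N.
  have -> : (N - i.+2).+1 = (N - i.+1)%N by lia.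
  rewrite (Wodd i (ltnW iN)) (Wodd i.+1 iN) /win_avg E1 E2.
  rewrite (odd_avg (winl M i)) ?(odd_avg (winl M i.+1)); [|rewrite /winl; lia..].
  have -> : (N - winl M i = (N - i.+2 + M).+2)%N by rewrite /winl; lia.
  have -> : (N - winl M i.+1 = (N - i.+2 + M).+1)%N by rewrite /winl; lia.
  by rewrite !opprK [- W i + _]addrC [- avg _ _ _ + _]addrC; apply; lia.
- have E1 : winr N M i.+1 = winr N M i by rewrite /winr; lia.
  have E3 : winl M i.+1 = winl M i by rewrite /winl; lia.
  by rewrite /win_avg E1 E3 subrr mulr_ge0 // subr_ge0 Wm.
Qed.

(* Constant slope off the central steps, where the window average does not move. *)
Definition clamp_potential i : R := ((i - M)%N%:R - (N - M.+1 - i)%N%:R) / N%:R.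

(** As [N <= M.*2], a window that moves is cut off on exactly one side. Its average is then a
    difference of triangular numbers ([S1], [S2]), and with [l] the window size before the step the
    claim reduces to [l * (l + 1) <= n ^+ 2], true because [l + 1 <= n]. *)
Lemma clamp_potentialP : (N <= M.*2)%N ->
  contracting_potential N M clamp_potential (1 - M%:R / N%:R) 1.
Proof.
move=> NM; have N0 : 0 < N%:R :> R by rewrite ltr0n (leq_trans M0).
have MNR : M%:R <= N%:R :> R by rewrite ler_nat.
have stepE i : (i.+1 < N)%N -> ((i + M).+1 < N \/ M <= i)%N ->
    clamp_potential i.+1 - clamp_potential i = N%:R^-1.
  move=> iN h; rewrite /clamp_potential -mulrBl -[RHS]mul1r; congr (_ / _).
  have [h1|h1] := boolP (M <= i)%N.
    have -> : (i.+1 - M = (i - M).+1)%N by lia.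
    have -> : (N - M.+1 - i.+1 = 0)%N by lia.
    have -> : (N - M.+1 - i = 0)%N by lia.
    by rewrite -natr1; ring.
  have -> : (i.+1 - M = 0)%N by lia.
  have -> : (i - M = 0)%N by lia.
  have -> : (N - M.+1 - i = (N - M.+1 - i.+1).+1)%N by lia.
  by rewrite -natr1; ring.
apply: odd_contracting_potential.
- move=> k kN; rewrite /clamp_potential -mulNr opprB; congr ((_%:R - _%:R) / _); lia.
- move=> i iN; rewrite ler_pM2r ?invr_gt0 // lerB // ler_nat; lia.
- by move=> i iN h; rewrite stepE.
- rewrite /clamp_potential -mulrBl ler_pdivrMr // mul1r.
  have -> : (N.-1 - M = N - M.+1)%N by lia.
  have -> : (N - M.+1 - N.-1 = 0)%N by lia.
  rewrite sub0n subn0 !sub0r subr0 opprK -natrD ler_nat; lia.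
- by rewrite subr_ge0 ler_pdivrMr // mul1r.
- move=> i iN; rewrite stepE //; [|lia|by left].
  rewrite avg_recr //; set L := (i + M).+1.
  have LM : (M < L)%N by rewrite /L; lia.
  have S1 n : (2 * \sum_(0 <= k < n) (k - M) = (n - M) * (n - M).-1)%N.
    elim: n => [|n IHn]; first by rewrite big_geq.
    rewrite big_nat_recr //= mulnDr IHn; have [h|h] := leqP M n.
      have -> : (n.+1 - M = (n - M).+1)%N by lia.
      by case: (n - M)%N => //= q; lia.
    have -> : (n.+1 - M = 0)%N by lia.
    by have -> : (n - M = 0)%N by lia.
  have S2 c n : (c <= n)%N -> (2 * \sum_(0 <= k < n) (c - k) = c * c.+1)%N.
    elim: n c => [|n IHn] c; first by rewrite leqn0 => /eqP->; rewrite big_geq.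
    rewrite big_nat_recl // mulnDr; case: c => [|c] cn.
      by rewrite big1 // => k _; rewrite sub0n.
    rewrite (eq_bigr (fun k => (c - k)%N)) => [|k _]; last by rewrite subSS.
    by rewrite IHn //; lia.
  have -> : avg clamp_potential 0 L = ((L - M)%:R * (L - M).-1%:R -
      (N - M.+1)%:R * (N - M)%:R) / (2 * L%:R * N%:R).
    rewrite /avg /clamp_potential subn0 -mulr_suml sumrB -!natr_sum.
    have := S1 L; move/(congr1 (fun n => n%:R : R)); rewrite !natrM => <-.
    have := S2 (N - M.+1)%N L; have -> : (N - M.+1).+1 = (N - M)%N by lia.
    have cL : (N - M.+1 <= L)%N by lia.
    move=> /(_ cL)/(congr1 (fun n => n%:R : R)); rewrite !natrM => <-.
    by field; rewrite (lt0r_neq0 N0) pnatr_eq0.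
  rewrite subn0 /clamp_potential.
  have -> : (N - M.+1 - L = 0)%N by lia.
  have -> : (L - M)%:R = L%:R - M%:R :> R by rewrite natrB // ltnW.
  have -> : (L - M).-1%:R = L%:R - M%:R - 1 :> R.
    by rewrite -subn1 !natrB // ?subn_gt0 // ltnW.
  have -> : (N - M.+1)%:R = N%:R - M%:R - 1 :> R.
    by rewrite natrB ?(leq_trans LM) // -?natr1 ?opprD ?addrA // ltnW.
  rewrite natrB // -natr1 subr0.
  have L0 : 0 < L%:R :> R by rewrite ltr0n.
  have L10 : 0 < L%:R + 1 :> R by rewrite natr1 ltr0n.
  have NL : L%:R + 1 <= N%:R :> R by rewrite natr1 ler_nat.
  have NM' : N%:R <= 2 * M%:R :> R by rewrite -natrM ler_nat mul2n.
  rewrite ler_pdivrMr // -subr_ge0.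
  set l := L%:R in L0 L10 NL *; set m := M%:R in MNR NM' *; set n := N%:R in N0 NL NM' MNR *.
  rewrite [X in 0 <= X](_ : _ =
    (n ^+ 2 * (2 * m + 1 - n) - (2 * m - n) * (l * (l + 1))) / (2 * l * n ^+ 2)); last first.
    by field; rewrite !lt0r_neq0.
  apply: divr_ge0; last by rewrite !mulr_ge0 ?exprn_ge0 // ltW.
  rewrite subr_ge0.
  have : (2 * m - n) * (l * (l + 1)) <= (2 * m - n) * n ^+ 2.
    rewrite ler_wpM2l ?subr_ge0 // expr2 ler_pM // ltW //; lra.
  move/le_trans; apply; rewrite mulrC ler_wpM2l ?sqr_ge0 //; lra.
- by move=> i Mi iN; lia.
Qed.

Definition cubic_potential i : R :=
  let y := (2 * i%:R + 1) / N%:R - 1 in 9 * y - y ^+ 3.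

(** In the continuum, averaging over a full window of radius r turns y^3 into y^3 + r^2 y, so the
    slope W' of W = 9 y - y^3 becomes W' - r^2, at most (1 - r^2 / 9) W' because W' <= 9. Near an
    end only one side of the window moves and the average has slope at most 9 / 2, while (1 - r^2 /
    9) W' is at least (8 / 9) 6. *)
Lemma cubic_potentialP r : 0 < r <= 1 -> r / 2 <= M%:R / N%:R ->
  contracting_potential N M cubic_potential (1 - r ^+ 2 / 9) 18.
Proof.
move=> /andP[r0 r1] rM; have N0 : 0 < N%:R :> R by rewrite ltr0n (leq_trans M0).
have NV : 0 < N%:R^-1 :> R by rewrite invr_gt0.
pose y (i : nat) : R := (2 * i%:R + 1) / N%:R - 1.
have WE i : cubic_potential i = 9 * y i - y i ^+ 3 by [].
have yS i : y i.+1 = y i + 2 * N%:R^-1 by rewrite /y -natr1; ring.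
have y1 i : (i < N)%N -> -1 <= y i <= 1.
  move=> iN; rewrite /y lerBDr addrC subrr divr_ge0 ?addr_ge0 ?mulr_ge0 //=.
  rewrite lerBDr ler_pdivrMr //; have : i%:R + 1 <= N%:R :> R by rewrite natr1 ler_nat.
  lra.
have r2 : r ^+ 2 <= 1 by rewrite expr_le1 // ltW.
have sE i : cubic_potential i.+1 - cubic_potential i =
    2 * N%:R^-1 * (9 - (y i ^+ 2 + y i * y i.+1 + y i.+1 ^+ 2)).
  rewrite !WE yS; ring.
(* Neighbouring centres are [2 / N] apart and the slope lies between 6 and 9, hence increments
   between [12 / N] and [18 / N]. *)
have s12 i : (i.+1 < N)%N -> 12 * N%:R^-1 <= cubic_potential i.+1 - cubic_potential i.
  move=> iN; rewrite sE; have := y1 _ iN; have := y1 _ (ltnW iN).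
  move: (y i) (y i.+1) => u v /andP[u1 u2] /andP[v1 v2].
  have : u ^+ 2 + u * v + v ^+ 2 <= 3 by nra.
  nra.
have s18 i : cubic_potential i.+1 - cubic_potential i <= 18 * N%:R^-1.
  rewrite sE; move: (y i) (y i.+1) => u v.
  have : 0 <= u ^+ 2 + u * v + v ^+ 2 by nra.
  nra.
apply: odd_contracting_potential.
- move=> k kN; rewrite !WE; have -> : y (N - k.+1)%N = - y k.
    rewrite /y natrB // -natr1; field; exact: lt0r_neq0.
  by ring.
- by move=> i iN; rewrite -subr_ge0 (le_trans _ (s12 i iN)) // mulr_ge0 // ltW.
- move=> i iN _; rewrite (le_trans _ (s12 i iN)) //; lra.
- have N1 : (N.-1 < N)%N by rewrite prednK // (leq_trans M0).
  have N0' : (0 < N)%N by rewrite (leq_trans M0).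
  rewrite !WE; have := y1 _ N1; have := y1 _ N0'.
  have bound (w : R) : -1 <= w <= 1 -> `|9 * w - w ^+ 3| <= 9.
    move=> w1; have -> : 9 * w - w ^+ 3 = w * (9 - w ^+ 2) by ring.
    rewrite normrM -[leRHS]mul1r; apply: ler_pM => //; first by rewrite ler_norml.
    rewrite ler_norml; nra.
  by move=> /bound + /bound; rewrite !ler_norml => /andP[? ?] /andP[? ?]; lra.
- lra.
- move=> i iN; rewrite avg_recr //; set L := (i + M).+1.
  (* Going back from [L] at the largest slope, the average over [L] cells is at most
     [18 / N * (L + 1) / 2] below the value at [L]. Division by the new window size [L + 1] leaves
     [9 / N]. *)
  have lin k : (k <= L)%N -> cubic_potential L - cubic_potential k <= 18 * N%:R^-1 * (L - k)%:R.
    move=> /subnK<-; elim: (L - k)%N => [|n IHn].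
      by rewrite subrr addnK mulr0.
    have := s18 (n + k)%N; move: IHn; rewrite !addnK addSn -natr1; lra.
  have : cubic_potential L - 18 * N%:R^-1 * ((L%:R + 1) / 2) <= avg cubic_potential 0 L.
    have -> : cubic_potential L - 18 * N%:R^-1 * ((L%:R + 1) / 2) =
       avg (fun k => cubic_potential L - 18 * N%:R^-1 * (L - k)%:R) 0 L.
      rewrite avgB avgZ avg_const //; congr (_ - _ * _).
      rewrite /avg subn0 -natr_sum; apply: (canRL (mulfK _)); first by rewrite pnatr_eq0.
      have : (2 * \sum_(0 <= k < L) (L - k) = L * L.+1)%N.
        elim: (L) => [|l IHl]; first by rewrite big_geq.
        by rewrite big_nat_recl // mulnDr; under eq_bigr do rewrite subSS; rewrite IHl; lia.
      by move/(congr1 (fun n => n%:R : R)); rewrite !natrM -[L.+1%:R]natr1; lra.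
    apply: ler_avg => k /andP[_ kL]; have := lin k (ltnW kL); lra.
  move=> avgL; have L0 : 0 < L%:R + 1 :> R by rewrite natr1 ltr0n.
  rewrite subn0 -[L.+1%:R]natr1 ler_pdivrMr //.
  have st : 9 * N%:R^-1 <= (1 - r ^+ 2 / 9) * (cubic_potential i.+1 - cubic_potential i).
    have iN' : (i.+1 < N)%N by lia.
    have := s12 i iN'; nra.
  have := ler_wpM2r (ltW L0) st; lra.
- move=> i Mi iN; rewrite /avg.
  have -> : ((i + M).+2 - (i.+1 - M) = M.*2.+1)%N by lia.
  have -> : ((i + M).+1 - (i - M) = M.*2.+1)%N by lia.
  rewrite -mulrBl big_nat_recr /=; last by lia.
  rewrite [in X in _ - X]big_ltn /=; last by lia.
  have -> : (i.+1 - M = (i - M).+1)%N by lia.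
  rewrite [X in X / _](_ : _ = cubic_potential (i + M).+1 - cubic_potential (i - M)); last by ring.
  rewrite !WE.
  (* [z] is the midpoint of the two neighbouring centres, so the four points involved are symmetric
     about it and the even terms cancel. *)
  pose n : R := N%:R; pose m : R := M%:R; pose z := y i + n^-1.
  have -> : y (i + M).+1 = z + (2 * m + 1) / n.
    by rewrite /z /y -[(i + M).+1%:R]natr1 natrD; field; exact: lt0r_neq0.
  have -> : y (i - M)%N = z - (2 * m + 1) / n.
    by rewrite /z /y natrB //; field; exact: lt0r_neq0.
  have -> : y i.+1 = z + n^-1 by rewrite yS /z -/n; ring.
  have -> : y i = z - n^-1 by rewrite /z; ring.
  have -> : M.*2.+1%:R = 2 * m + 1 :> R by rewrite -[M.*2.+1%:R]natr1 -mul2n natrM.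
  have m0 : 0 < m by rewrite ltr0n.
  have mn : r / 2 <= m * n^-1 by [].
  have nV : 0 < n^-1 by [].
  rewrite [leLHS](_ : _ = (18 - 6 * z ^+ 2 - 2 * ((2 * m + 1) * n^-1) ^+ 2) * n^-1); last first.
    by field; rewrite !lt0r_neq0 //; lra.
  rewrite [X in _ <= _ * X](_ : _ = (18 - 6 * z ^+ 2 - 2 * n^-1 ^+ 2) * n^-1); last by ring.
  rewrite [leRHS]mulrA ler_pM2r //.
  have : r ^+ 2 <= 4 * (m * n^-1) ^+ 2 by nra.
  have : 0 <= m * n^-1 * n^-1 by rewrite !mulr_ge0 // ltW.
  have : 0 <= r ^+ 2 * z ^+ 2 by rewrite mulr_ge0 ?sqr_ge0.
  have : 0 <= r ^+ 2 * n^-1 ^+ 2 by rewrite mulr_ge0 ?sqr_ge0.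
  nra.
Qed.
End Potentials.

(** * The coordinate function under window averages *)

Section CellCenter.
Variables (R : realFieldType) (N M : nat).
Hypotheses (M0 : (0 < M)%N) (MN : (M <= N)%N).

Definition center (i : nat) : R := (2 * i%:R + 1) / N%:R - 1.

Let N0 : 0 < N%:R :> R. Proof. by rewrite ltr0n (leq_trans M0). Qed.

Lemma center_itv i : (i < N)%N -> -1 <= center i <= 1.
Proof.
move=> iN; rewrite /center lerBDr addrC subrr divr_ge0 ?addr_ge0 ?mulr_ge0 //=.
rewrite lerBDr ler_pdivrMr //; have : i%:R + 1 <= N%:R :> R by rewrite natr1 ler_nat.
lra.
Qed.

Lemma center_rev i : (i < N)%N -> center (N - i.+1) = - center i.
Proof.
by move=> iN; rewrite /center natrB // -[i.+1%:R]natr1; field; exact: lt0r_neq0.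
Qed.

Lemma win_avg_center i : (i < N)%N ->
  win_avg N M center i = ((winl M i)%:R + (winr N M i)%:R) / N%:R - 1.
Proof.
move=> iN; rewrite /win_avg; have := win_lt M0 MN iN; move: (winl M i) (winr N M i) => a b ab.
have S : \sum_(a <= k < b) (2 * k%:R + 1) = (b%:R - a%:R) * (b%:R + a%:R) :> R.
  move: ab => /ltnW/subnK<-; elim: (b - a)%N => [|k IHk].
    by rewrite big_geq // subrr mul0r.
  rewrite addSn big_nat_recr ?leq_addl //= IHk -[(k + a).+1%:R]natr1; ring.
rewrite /center avgB avg_const //; congr (_ - _).
rewrite /avg -mulr_suml S natrB 1?ltnW //; field.
by rewrite lt0r_neq0 //= subr_eq0 eqr_nat gtn_eqF.
Qed.

Lemma winl_ge i : i%:R - M%:R <= (winl M i)%:R :> R.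
Proof. by rewrite lerBlDr -natrD ler_nat /winl; lia. Qed.

(** The average is the midpoint of the window. For y >= 0 it is at least y if the window is not cut
    off on the right, and otherwise essentially at least (1 + y - r) / 2, which exceeds (1 - r / 2)
    y by (1 - r) (1 - y) / 2. The terms [w] and [N^-1] absorb the discretization. *)
Lemma win_avg_center_pos i (r w : R) : (i < N)%N -> 0 < r <= 1 -> 2 * M%:R / N%:R <= r + w ->
  0 <= w -> 0 <= center i ->
  (1 - r / 2) * center i - (w + N%:R^-1) <= win_avg N M center i.
Proof.
have winrE : winr N M i = N \/ winr N M i = (i + M).+1 by rewrite /winr; lia.
move=> iN /andP[r0 r1] rM w0 c0; rewrite win_avg_center //.
have /andP[_ c1] := center_itv iN.
have NV : 0 < N%:R^-1 :> R by rewrite invr_gt0.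
have NN : N%:R * N%:R^-1 = 1 :> R by rewrite divff // lt0r_neq0.
have := ler_wpM2r (ltW NV) (winl_ge i).
have cE : center i = 2 * (i%:R * N%:R^-1) + N%:R^-1 - 1 by rewrite /center; ring.
have h3 : 2 * (M%:R * N%:R^-1) <= r + w by rewrite mulrA.
have h4 : 0 <= (1 - r) * (1 - center i) by rewrite mulr_ge0 // subr_ge0.
rewrite [X in X <= _ -> _]mulrBl [X in _ -> _ <= X - 1]mulrDl.
have [E|E] := winrE.
  rewrite E NN; lra.
have h6 : 0 <= r * center i by rewrite mulr_ge0 // ltW.
rewrite E -[(i + M).+1%:R]natr1 natrD [X in _ -> _ <= _ + X - 1]mulrDl.
rewrite [X in _ -> _ <= _ + (X + _) - 1]mulrDl mul1r; lra.
Qed.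

Lemma win_avg_center_rev i : (i < N)%N ->
  win_avg N M center (N - i.+1) = - win_avg N M center i.
Proof.
move=> iN; rewrite !win_avg_center //; last by lia.
have lN : (winl M i <= N)%N by rewrite /winl; lia.
have rN : (winr N M i <= N)%N by rewrite geq_minl.
have -> : (winl M (N - i.+1) = N - winr N M i)%N by rewrite /winl /winr; lia.
have -> : (winr N M (N - i.+1) = N - winl M i)%N by rewrite /winl /winr; lia.
move: (winl M i) (winr N M i) lN rN => a b aN bN.
by rewrite !natrB //; field; exact: lt0r_neq0.
Qed.

Lemma center_win_avg_ge i (r w : R) : (i < N)%N -> 0 < r <= 1 ->
  2 * M%:R / N%:R <= r + w -> 0 <= w ->
  (1 - r / 2) * center i ^+ 2 - (w + N%:R^-1) <= center i * win_avg N M center i.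
Proof.
move=> iN r01 rM w0; have NV : 0 < N%:R^-1 :> R by rewrite invr_gt0.
wlog c0 : i iN / 0 <= center i.
  move=> pos; have [/pos -/(_ iN) //|c0] := leP 0 (center i).
  have iN' : (N - i.+1 < N)%N by lia.
  have := pos _ iN'; rewrite win_avg_center_rev // center_rev // oppr_ge0 mulrNN sqrrN.
  by apply; exact: ltW.
have := win_avg_center_pos iN r01 rM w0 c0; have := center_itv iN; nra.
Qed.

Lemma center_win_avg_ge0 i : (i < N)%N -> 0 <= center i * win_avg N M center i.
Proof.
move=> iN; have NV : 0 < N%:R^-1 :> R by rewrite invr_gt0.
wlog c0 : i iN / 0 <= center i.
  move=> pos; have [/pos -/(_ iN) //|c0] := leP 0 (center i).
  have iN' : (N - i.+1 < N)%N by lia.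
  have := pos _ iN'; rewrite win_avg_center_rev // center_rev // oppr_ge0 mulrNN.
  by apply; exact: ltW.
rewrite mulr_ge0 // win_avg_center // subr_ge0 ler_pdivlMr // mul1r -natrD ler_nat.
move: c0; rewrite /center subr_ge0 ler_pdivlMr // mul1r.
rewrite -natrM natr1 ler_nat /winl /winr; lia.
Qed.

(** Here the window ends at the right end of the grid, so its midpoint is exactly [(i - M) / N]; the
    centre itself is at least as large. *)
Lemma center_win_avg_ge_sqr i : (N <= M.*2)%N -> (M <= i < N)%N ->
  ((i - M)%:R / N%:R) ^+ 2 <= center i * win_avg N M center i.
Proof.
move=> NM /andP[Mi iN]; rewrite win_avg_center // expr2.
have -> : winr N M i = N by rewrite /winr; lia.
have -> : ((winl M i)%:R + N%:R) / N%:R - 1 = (i - M)%:R / N%:R :> R.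
  by field; exact: lt0r_neq0.
rewrite ler_pM ?divr_ge0 //.
rewrite /center natrB // -subr_ge0.
rewrite [X in 0 <= X](_ : _ = (i%:R + 1 + M%:R - N%:R) / N%:R); last first.
  by field; exact: lt0r_neq0.
rewrite divr_ge0 // subr_ge0.
have : N%:R <= 2 * M%:R :> R by rewrite -natrM ler_nat mul2n.
have : M%:R <= i%:R :> R by rewrite ler_nat.
lra.
Qed.

(** The terms below [M] are nonnegative and dropped; the others dominate a sum of squares, whence
    the cube and the factor 1/3. *)
Lemma sum_center_win_avg_ge : (N <= M.*2)%N -> (M < N)%N ->
  3^-1 * ((N - M).-1%:R / N%:R) ^+ 3 <=
  N%:R^-1 * \sum_(0 <= i < N) center i * win_avg N M center i.
Proof.
move=> NM MN'; rewrite (big_cat_nat (leq0n M) MN) /=.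
have S K : (K.-1%:R) ^+ 3 <= 3 * \sum_(0 <= u < K) u%:R ^+ 2 :> R.
  elim: K => [|[|K] IHK]; first by rewrite big_geq // mulr0 expr0n.
    by rewrite big_nat1 !expr0n mulr0.
  rewrite big_nat_recr //= mulrDr; apply: le_trans (lerD IHK (lexx _)) => /=.
  rewrite -[K.+1%:R]natr1; have := ler0n R K; nra.
have T : \sum_(0 <= u < N - M) (u%:R / N%:R) ^+ 2 <=
    \sum_(M <= i < N) center i * win_avg N M center i.
  rewrite -[X in _ <= \sum_(X <= _ < _) _]add0n big_addn; apply: ler_sum_nat => u /andP[_ uNM].
  by have := @center_win_avg_ge_sqr (u + M) NM; rewrite addnK; apply; lia.
have U : 0 <= \sum_(0 <= i < M) center i * win_avg N M center i.
  rewrite big_nat_cond sumr_ge0 // => i /andP[/andP[_ iM] _].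
  by apply: center_win_avg_ge0; exact: leq_trans MN.
have NV : 0 < N%:R^-1 :> R by rewrite invr_gt0.
have : N%:R^-1 * \sum_(0 <= u < N - M) (u%:R / N%:R) ^+ 2 <=
  N%:R^-1 * (\sum_(0 <= i < M) center i * win_avg N M center i +
   \sum_(M <= i < N) center i * win_avg N M center i).
  by rewrite ler_pM2l //; lra.
apply: le_trans; have := S (N - M)%N.
under [X in _ -> _ <= _ * X]eq_bigr do rewrite expr_div_n -exprVn.
rewrite -mulr_suml exprMn => h.
have := ler_wpM2r (exprn_ge0 3 (ltW NV)) h.
move: (\sum_(_ <= _ < _) _) (_ ^+ 3) => x y; rewrite !exprS; lra.
Qed.

(** The exact value is [(1 - N^-2) / 3], equal to 1/4 for [N = 2]. *)
Lemma sum_center_sqr : (1 < N)%N ->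
  4^-1 <= N%:R^-1 * \sum_(0 <= i < N) center i ^+ 2 :> R.
Proof.
move=> N1; have NN := lt0r_neq0 N0.
have S K : 3 * \sum_(0 <= i < K) (2 * i%:R + 1 - N%:R) ^+ 2 =
    K%:R * (4 * K%:R ^+ 2 - 1 - 6 * N%:R * K%:R + 3 * N%:R ^+ 2) :> R.
  elim: K => [|K IHK]; first by rewrite big_geq // mulr0 mul0r.
  by rewrite big_nat_recr //= mulrDr IHK -[K.+1%:R]natr1; ring.
have -> : \sum_(0 <= i < N) center i ^+ 2 =
    N%:R^-1 ^+ 2 * \sum_(0 <= i < N) (2 * i%:R + 1 - N%:R) ^+ 2.
  by rewrite mulr_sumr; apply: eq_bigr => i _; rewrite /center; field.
have := S N; set x := \sum_(_ <= _ < _) _ => xE.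
have -> : x = N%:R * (N%:R ^+ 2 - 1) / 3.
  by rewrite -(mulKf (_ : 3 != 0 :> R) x) ?pnatr_eq0 // xE; field.
have -> : N%:R^-1 * (N%:R^-1 ^+ 2 * (N%:R * (N%:R ^+ 2 - 1) / 3)) = (1 - N%:R^-1 ^+ 2) / 3 :> R.
  by field.
have : N%:R^-1 <= 2^-1 :> R by rewrite lef_pV2 ?posrE ?ler_nat.
have : 0 <= N%:R^-1 :> R by rewrite invr_ge0.
nra.
Qed.
End CellCenter.

(** * Box averages on a grid *)

Section Grid.
Variables (R : realFieldType) (d n M : nat).
Local Notation N := n.+1.
Hypotheses (M0 : (0 < M)%N) (MN : (M <= N)%N).
Local Notation cell := {ffun 'I_d -> 'I_N}.
Implicit Types (g : cell -> R) (c : cell) (k : 'I_d) (W : nat -> R).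

Definition in_win (i j : nat) := (winl M i <= j < winr N M i)%N.

Definition cell_nbhd c : {set cell} := [set c' : cell | [forall k, in_win (c k) (c' k)]].

Definition cell_avg g c : R := (\sum_(c' in cell_nbhd c) g c') / #|cell_nbhd c|%:R.

Definition set_coord c k (t : 'I_N) : cell := [ffun l => if l == k then t else c l].

Let q (i j : nat) : R := (in_win i j)%:R / (winr N M i - winl M i)%:R.

Lemma sum_in_win (f : nat -> R) (i : nat) :
  \sum_(j < N) (in_win i j)%:R * f j = \sum_(winl M i <= j < winr N M i) f j.
Proof.
rewrite (@big_nat_widen _ _ _ (winl M i) (winr N M i) N) ?geq_minl //.
rewrite (@big_nat_widenl _ _ _ (winl M i) 0) // big_mkord [RHS]big_mkcond.
by apply: eq_bigr => j _; rewrite /in_win andbC; case: ifP; rewrite ?mul1r ?mul0r.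
Qed.

Let sum_q (f : nat -> R) (i : nat) : \sum_(j < N) q i j * f j = win_avg N M f i.
Proof.
rewrite /win_avg /avg -sum_in_win mulr_suml; apply: eq_bigr => j _.
by rewrite /q mulrAC.
Qed.

Lemma card_cell_nbhd c :
  #|cell_nbhd c|%:R = \prod_k (winr N M (c k) - winl M (c k))%:R :> R.
Proof.
transitivity (\prod_k \sum_(j < N) (in_win (c k) j)%:R : R); last first.
  apply: eq_bigr => k _; rewrite -[RHS]mulr1n -sumr_const_nat -sum_in_win.
  by apply: eq_bigr => j _; rewrite mulr1.
rewrite bigA_distr_bigA -sum1_card natr_sum big_mkcond; apply: eq_bigr => c' _.
by rewrite inE -natr_prod; case: forallP => [h|/forallP/forallPn[k /negPf hk]];
  [rewrite big1 // => k _; rewrite h | rewrite (bigD1 k) //= hk mul0n].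
Qed.

Lemma card_cell_nbhd_gt0 c : 0 < #|cell_nbhd c|%:R :> R.
Proof.
by rewrite card_cell_nbhd prodr_gt0 // => k _; rewrite ltr0n subn_gt0 win_lt.
Qed.

Let cell_avgE g c : cell_avg g c = \sum_(c' : cell) (\prod_k q (c k) (c' k)) * g c'.
Proof.
rewrite /cell_avg card_cell_nbhd big_mkcond mulr_suml; apply: eq_bigr => c' _.
rewrite prodf_div inE; case: forallP => [h|/forallP/forallPn[k /negPf hk]].
  rewrite (big1 _ _ (fun k => (in_win (c k) (c' k))%:R)) ?mul1r ?[g c' / _]mulrC //.
  by move=> k _; rewrite h.
by rewrite [in RHS](bigD1 k) //= hk !mul0r.
Qed.

(** Exchanging the [k]-th coordinate of the cell with the free index [t] is an involution on pairs,
    so replacing a coordinate in all possible ways hits every cell [N] times. *)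
Lemma sum_set_coord k (F : cell -> R) :
  \sum_c F c = N%:R^-1 * \sum_(c : cell) \sum_t F (set_coord c k t).
Proof.
rewrite pair_bigA /=.
pose flip (p : cell * 'I_N) := (set_coord p.1 k p.2, p.1 k).
have flipK : involutive flip.
  case=> c t; rewrite /flip /= ffunE eqxx; congr (_, _).
  by apply/ffunP => l; rewrite !ffunE; case: eqP => // ->.
have -> : \sum_p F (set_coord p.1 k p.2) = \sum_(p : cell * 'I_N) F p.1.
  by rewrite [RHS](reindex flip) //; exists flip => ? _; exact: flipK.
rewrite -(pair_bigA _ (fun c (t : 'I_N) => F c)) /= mulr_sumr; apply: eq_bigr => c _.
by rewrite sumr_const card_ord -[F c *+ _]mulr_natl mulKf ?pnatr_eq0.
Qed.

Let line g c k (t : nat) := g (set_coord c k (inord t)).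
Let wt c k (c' : cell) : R := \prod_(l | l != k) q (c l) (c' l).

(** Isolates one axis. The sum runs over cells instead of lines parallel to that axis, so each line
    occurs [N] times; this is compensated by the factor in front. *)
Let cell_avg_line g c k (t : 'I_N) : cell_avg g (set_coord c k t) =
  N%:R^-1 * \sum_c' wt c k c' * win_avg N M (line g c' k) t.
Proof.
rewrite cell_avgE (sum_set_coord k); congr (_ * _); apply: eq_bigr => c' _.
rewrite -sum_q mulr_sumr; apply: eq_bigr => u _.
rewrite (bigD1 k) //= !ffunE eqxx /line inord_val mulrA [_ * q _ _]mulrC.
congr (_ * _ * _); apply: eq_bigr => l /negPf lk.
by rewrite !ffunE lk.
Qed.

Let wt_ge0 c k c' : 0 <= wt c k c'.
Proof. by apply: prodr_ge0 => l _; rewrite divr_ge0. Qed.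

Let wt_sum c k : N%:R^-1 * \sum_c' wt c k c' = 1.
Proof.
have := cell_avg_line (fun=> 1) c k (c k); rewrite /cell_avg sumr_const.
rewrite -[1 *+ _]mulr_natr mul1r divff ?lt0r_neq0 ?card_cell_nbhd_gt0 // => E.
rewrite [RHS]E; congr (_ * _); apply: eq_bigr => c' _.
by rewrite /win_avg avg_const ?mulr1 // win_lt.
Qed.

Lemma cell_avgB g1 g2 c : cell_avg (fun c => g1 c - g2 c) c = cell_avg g1 c - cell_avg g2 c.
Proof. by rewrite /cell_avg sumrB mulrBl. Qed.

Lemma cell_avgZ x g c : cell_avg (fun c => x * g c) c = x * cell_avg g c.
Proof. by rewrite /cell_avg -mulr_sumr mulrA. Qed.

Lemma norm_cell_avg_le B g c : (forall c, `|g c| <= B) -> `|cell_avg g c| <= B.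
Proof.
move=> gB; rewrite /cell_avg normrM normfV normr_nat.
rewrite ler_pdivrMr ?card_cell_nbhd_gt0 // (le_trans (ler_norm_sum _ _ _)) //.
by rewrite (le_trans (ler_sum _ (fun c _ => gB c))) // sumr_const mulr_natr.
Qed.

Definition cell_lipschitz W L g := forall c k (t : nat), (t.+1 < N)%N ->
  `|g (set_coord c k (inord t.+1)) - g (set_coord c k (inord t))|
    <= L * (W t.+1 - W t).

(* On a line along one axis, the cell average is a convex combination of
   one-dimensional window averages. *)
Let cell_avg_step g c k (t : nat) x : (t.+1 < N)%N ->
  (forall c', `|win_avg N M (line g c' k) t.+1 - win_avg N M (line g c' k) t| <= x) ->
  `|cell_avg g (set_coord c k (inord t.+1)) - cell_avg g (set_coord c k (inord t))| <= x.
Proof.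
move=> tN gx; rewrite !cell_avg_line -mulrBr -sumrB normrM ger0_norm ?invr_ge0 //.
rewrite !inordK ?(ltnW tN) //.
rewrite -[leRHS]mul1r -[X in _ <= X * _](wt_sum c k) -[leRHS]mulrA ler_pM2l ?invr_gt0 // mulr_suml.
rewrite (le_trans (ler_norm_sum _ _ _)) // ler_sum // => c' _.
by rewrite -mulrBr normrM ger0_norm // ler_wpM2l.
Qed.

Lemma cell_avg_lipschitz W kappa B g L :
  contracting_potential N M W kappa B -> 0 <= L ->
  cell_lipschitz W L g -> cell_lipschitz W (kappa * L) (cell_avg g).
Proof.
move=> cW L0 gL c k t tN; apply: cell_avg_step => // c'.
by apply: win_avg_lipschitz cW L0 _ _ tN => // i iN; exact: gL.
Qed.

(** The start of the contraction: one average makes any bounded function Lipschitz for the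
    potential. If the window stays, so does the average; if it moves, [potential_step] makes [W]
    grow by at least [1 / N]. *)
Lemma cell_avg_smooth W kappa B g :
  contracting_potential N M W kappa B -> (forall c, `|g c| <= 1) ->
  cell_lipschitz W (4 * N%:R / M%:R) (cell_avg g).
Proof.
move=> [Wm Ws _ _] g1 c k t tN; apply: cell_avg_step => // c'.
have [[E1 E2]|/eqP neq] := eqVneq (winl M t.+1, winr N M t.+1) (winl M t, winr N M t).
  rewrite /win_avg E1 E2 subrr normr0 !mulr_ge0 ?invr_ge0 // subr_ge0 Wm //.
apply: le_trans (_ : 4 * 1 / M%:R <= _).
  by apply: win_avg_smooth => // i _; exact: g1.
have -> : 4 * 1 / M%:R = 4 * N%:R / M%:R * N%:R^-1 :> R.
  by rewrite mulr1 mulrAC mulfK // pnatr_eq0.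
by rewrite ler_wpM2l ?Ws // !mulr_ge0 ?invr_ge0.
Qed.

(** The cell [c] is changed into [c'] one coordinate at a time, each change costing at most [L]
    times the range of [W]. *)
Lemma lipschitz_osc W kappa B L g c c' :
  contracting_potential N M W kappa B -> 0 <= L -> cell_lipschitz W L g ->
  `|g c' - g c| <= d%:R * (L * B).
Proof.
move=> [Wm _ Wr _] L0 gL.
have lineB c0 k t u : `|g (set_coord c0 k t) - g (set_coord c0 k u)| <= L * B.
  have WD (i j : nat) : (i <= j)%N -> (j < N)%N -> W i <= W j /\
      `|line g c0 k j - line g c0 k i| <= L * (W j - W i).
    move=> /subnK<-; elim: (j - i)%N => [|m IHm] mN.
      by rewrite !subrr normr0 mulr0.
    have [|m1 m2] := IHm; first exact: ltnW.
    split; first by rewrite (le_trans m1) // Wm.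
    rewrite -(subrKA (line g c0 k (m + i)%N)) (le_trans (ler_normD _ _)) //.
    have := gL c0 k _ mN; rewrite -/(line g c0 k _) -/(line g c0 k _); lra.
  wlog tu : t u / (u <= t)%N.
    by move=> tu; case: (leqP u t) => [|/ltnW]/tu //; rewrite distrC.
  have [_] := WD _ _ tu (ltn_ord t); rewrite /line !inord_val => /le_trans; apply.
  rewrite ler_wpM2l // (le_trans _ Wr) // lerB //.
    by have [] := WD t n (leq_ord t) (leqnn _).
  by have [] := WD 0%N u (leq0n _) (ltn_ord u).
pose mix (j : nat) : cell := [ffun l : 'I_d => if (l < j)%N then c' l else c l].
have -> : c = mix 0%N by apply/ffunP => l; rewrite ffunE.
have -> : c' = mix d by apply/ffunP => l; rewrite ffunE ltn_ord.
suff: forall j, (j <= d)%N -> `|g (mix j) - g (mix 0%N)| <= j%:R * (L * B) by apply.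
elim=> [|j IHj] jd; first by rewrite subrr normr0 mul0r.
rewrite -(subrKA (g (mix j))) (le_trans (ler_normD _ _)) //.
rewrite -natr1 mulrDl mul1r [leRHS]addrC lerD ?IHj //; last exact: ltnW.
pose k := Ordinal jd.
have -> : mix j.+1 = set_coord (mix j) k (c' k).
  apply/ffunP => l; rewrite !ffunE ltnS leq_eqVlt -[_ == j]/(l == k).
  by case: eqP => [->|_].
have {2}-> : mix j = set_coord (mix j) k (c k) by
  apply/ffunP => l; rewrite !ffunE; case: eqP => [->|//]; rewrite ltnn.
exact: lineB.
Qed.

(** After [s.+1] averages [g] is [lambda ^+ s.+1 * g] up to [s.+1 * eps], because averaging does not
    increase the sup norm. The first average provides the Lipschitz constant, the other [s] contract
    it. *)
Lemma approx_eigenfunction_osc W kappa B g (lambda eps : R) (s : nat) c c' :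
  contracting_potential N M W kappa B -> 0 <= kappa -> 0 <= lambda <= 1 ->
  (forall c, `|g c| <= 1) -> (forall c, `|lambda * g c - cell_avg g c| <= eps) ->
  lambda ^+ s.+1 * `|g c' - g c| <=
    d%:R * (kappa ^+ s * (4 * N%:R / M%:R) * B) + 2 * s.+1%:R * eps.
Proof.
move=> cW k0 /andP[l0 l1] g1 geps.
have iterL : cell_lipschitz W (kappa ^+ s * (4 * N%:R / M%:R)) (iter s.+1 cell_avg g).
  elim: s => [|s IHs]; first by rewrite mul1r; exact: cell_avg_smooth cW g1.
  rewrite exprS -mulrA; apply: cell_avg_lipschitz cW _ IHs.
  by rewrite !mulr_ge0 ?exprn_ge0 ?invr_ge0.
have iterE j c0 : `|lambda ^+ j * g c0 - iter j cell_avg g c0| <= j%:R * eps.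
  elim: j c0 => [|j IHj] c0; first by rewrite mul1r subrr normr0 mul0r.
  rewrite iterS exprSr -mulrA -(subrKA (lambda ^+ j * cell_avg g c0)).
  rewrite (le_trans (ler_normD _ _)) // -natr1 mulrDl mul1r [leRHS]addrC lerD //.
    rewrite -mulrBr normrM ger0_norm ?exprn_ge0 // (le_trans _ (geps c0)) //.
    by rewrite ler_piMl // exprn_ile1.
  rewrite -cell_avgZ -cell_avgB; exact: norm_cell_avg_le.
have B0 : 0 <= kappa ^+ s * (4 * N%:R / M%:R) by rewrite !mulr_ge0 ?exprn_ge0 ?invr_ge0.
have := lipschitz_osc c c' cW B0 iterL.
have := iterE s.+1 c; have := iterE s.+1 c'.
rewrite -[lambda ^+ s.+1 * `|_|](_ : `|lambda ^+ s.+1 * (g c' - g c)| = _); last first.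
  by rewrite normrM ger0_norm ?exprn_ge0.
rewrite mulrBr; move: (iter _ _ _ c) (iter _ _ _ c') (lambda ^+ _ * g c) (lambda ^+ _ * g c').
move: (_ * (_ * B)) => T x x' y y' h1 h2 h3.
have -> : y' - y = (y' - x') + (x' - x) - (y - x) by ring.
rewrite (le_trans (ler_normB _ _)) // (le_trans (lerD (ler_normD _ _) (lexx _))) //.
have -> : 2 * s.+1%:R * eps = s.+1%:R * eps + s.+1%:R * eps by ring.
move: h1 h2 h3; set u := _ * eps; lra.
Qed.

Lemma cell_avg_coord (f : nat -> R) c k :
  cell_avg (fun c : cell => f (c k)) c = win_avg N M f (c k).
Proof.
have cE : set_coord c k (c k) = c.
  by apply/ffunP => l; rewrite ffunE; case: eqP => [->|].
rewrite -{1}cE cell_avg_line -[RHS]mul1r -[X in _ = X * _](wt_sum c k) -[RHS]mulrA mulr_suml.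
congr (_ * _); apply: eq_bigr => c' _; congr (_ * _).
rewrite /win_avg /avg; congr (_ / _); apply: eq_big_nat => j /andP[_ jr].
by rewrite /line ffunE eqxx inordK // (leq_trans jr) // geq_minl.
Qed.

Lemma sum_coord (f : nat -> R) k :
  \sum_(c : cell) f (c k) = #|{: cell}|%:R * (N%:R^-1 * \sum_(0 <= i < N) f i).
Proof.
rewrite (sum_set_coord k) mulrCA big_mkord; congr (_ * _).
rewrite (eq_bigr (fun=> \sum_(i < N) f i)) => [|c _].
  by rewrite sumr_const mulr_natl.
by apply: eq_bigr => t _; rewrite ffunE eqxx.
Qed.

Lemma card_cell_nbhd_ge c : M%:R ^+ d <= #|cell_nbhd c|%:R :> R.
Proof.
rewrite card_cell_nbhd -[in leLHS](card_ord d) -prodr_const; apply: ler_prod => k _.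
rewrite ler0n /= ler_nat; have := win_size M0 MN (ltn_ord (c k)); lia.
Qed.

(** Reflecting all coordinates preserves the sizes of the boxes and flips the sign of the centre. *)
Lemma sum_cell_nbhd_center k :
  \sum_(c : cell) #|cell_nbhd c|%:R * center R N (c k) = 0.
Proof.
pose rev (c : cell) : cell := [ffun l => rev_ord (c l)].
have revK : involutive rev by move=> c; apply/ffunP => l; rewrite !ffunE rev_ordK.
set s := LHS; have : s = - s.
  rewrite {1}/s (reindex rev) /=; last by exists rev => ? _; exact: revK.
  rewrite /s -sumrN; apply: eq_bigr => c _.
  rewrite ffunE /= (center_rev R M0 MN) // -mulrN; congr (_ * _).
  rewrite !card_cell_nbhd; apply: eq_bigr => l _; congr _%:R.
  by rewrite ffunE /= /winl /winr; have := ltn_ord (c l); lia.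
by move/eqP; rewrite -addr_eq0 -mulr2n mulrn_eq0 => /eqP.
Qed.
End Grid.

(** * Adjacency sampled through a grid *)

Section NeighbourhoodCore.
Variables (R : realFieldType) (d n M : nat).
Local Notation N := n.+1.
Hypotheses (M0 : (0 < M)%N) (MN : (M <= N)%N).
Local Notation cell := {ffun 'I_d -> 'I_N}.
Local Notation nbhd := (@cell_nbhd d n M).

(** The distance of the indices is at most [M - 2]. One unit of the slack pays for the extent of the
    two cells, the other for the rounding up in [reach]. *)
Definition close_win (M i j : nat) := ((i + 2 <= j + M) && (j + 2 <= i + M))%N.

(* The cells all of whose points are adjacent to all points of [c], whereas
   [cell_nbhd] collects the cells that may contain a point adjacent to one of [c]. *)
Definition cell_core (c : cell) : {set cell} :=
  [set c' : cell | [forall k, close_win M (c k) (c' k)]].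

Lemma sum_indicator_le1 (P : pred 'I_N) :
  (forall i j, P i -> P j -> i = j) -> \sum_(j < N) (P j)%:R <= 1 :> R.
Proof.
move=> P1; rewrite -natr_sum -[1]/(1%:R) ler_nat.
have -> : (\sum_(j < N) P j = #|P|)%N.
  by rewrite -sum1_card [RHS]big_mkcond; apply: eq_bigr => j _; rewrite unfold_in; case: (P j).
by apply/card_le1_eqP => i j Pi Pj; exact: P1.
Qed.

(** Such a [j] is at distance [M - 1] or [M] from [i], on either side. *)
Lemma far_win_count (i : 'I_N) :
  \sum_(j < N) (in_win n M i j && ~~ close_win M i j)%:R <= 4 :> R.
Proof.
apply: le_trans (_ : \sum_(j < N) ((i == j + M :> nat)%N%:R + (i.+1 == j + M :> nat)%N%:R
   + (j == i + M :> nat)%N%:R + (j.+1 == i + M :> nat)%N%:R) <= _).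
  apply: ler_sum => j _; rewrite -!natrD ler_nat /in_win /close_win /winl /winr; lia.
rewrite !big_split /=.
have s1 (P : pred 'I_N) := @sum_indicator_le1 P.
have := s1 (fun j => i == j + M :> nat)%N; have := s1 (fun j => i.+1 == j + M :> nat)%N.
have := s1 (fun j => j == i + M :> nat)%N; have := s1 (fun j => j.+1 == i + M :> nat)%N.
move=> h1 h2 h3 h4.
have {}h1 := h1 ltac:(move=> a b; move=> /eqP ? /eqP ?; apply: val_inj => /=; lia).
have {}h2 := h2 ltac:(move=> a b; move=> /eqP ? /eqP ?; apply: val_inj => /=; lia).
have {}h3 := h3 ltac:(move=> a b; move=> /eqP ? /eqP ?; apply: val_inj => /=; lia).
have {}h4 := h4 ltac:(move=> a b; move=> /eqP ? /eqP ?; apply: val_inj => /=; lia).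
lra.
Qed.

(** Union bound over the axis on which closeness fails: on it at most 4 indices remain out of at
    least [M]. *)
Lemma card_nbhd_diff_core c :
  M%:R * #|nbhd c :\: cell_core c|%:R <= 4 * d%:R * #|nbhd c|%:R :> R.
Proof.
pose b k l (c' : cell) := if l == k then in_win n M (c l) (c' l) && ~~ close_win M (c l) (c' l)
  else in_win n M (c l) (c' l).
have bsum k : M%:R * \sum_(c' : cell) \prod_l (b k l c')%:R <= 4 * #|nbhd c|%:R :> R.
  pose b1 l (j : 'I_N) := if l == k then in_win n M (c l) j && ~~ close_win M (c l) j
    else in_win n M (c l) j.
  rewrite -(bigA_distr_bigA (fun l (j : 'I_N) => (b1 l j)%:R : R)) card_cell_nbhd /b1.
  rewrite (bigD1 k) //= [X in _ <= _ * X](bigD1 k) //= eqxx !mulrA.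
  have E : \prod_(l | l != k) \sum_(j < N) (b1 l j)%:R = \prod_(l | l != k) (winr N M (c l) - winl M (c l))%:R :> R.
    apply: eq_bigr => l /negPf lk; rewrite /b1 lk -[RHS]mulr1n -sumr_const_nat -sum_in_win.
    by apply: eq_bigr => j _; rewrite mulr1.
  rewrite E ler_wpM2r ?prodr_ge0 // mulrC ler_pM ?sumr_ge0 ?far_win_count //.
  by rewrite ler_nat; have := win_size M0 MN (ltn_ord (c k)); lia.
apply: le_trans (_ : M%:R * \sum_k \sum_(c' : cell) \prod_l (b k l c')%:R <= _); last first.
  rewrite mulr_sumr (le_trans (ler_sum _ (fun k _ => bsum k))) // sumr_const card_ord.
  by rewrite -[leLHS]mulr_natr; lra.
rewrite ler_wpM2l // -sum1_card natr_sum big_mkcond exchange_big.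
apply: ler_sum => c' _; case: ifPn => [|_]; last first.
  by apply: sumr_ge0 => k _; apply: prodr_ge0.
rewrite !inE => /andP[/forallPn[k hk] /forallP h]; rewrite (bigD1 k) //=.
rewrite big1 ?lerDl ?sumr_ge0 // => [k' _|l _]; first by apply: prodr_ge0.
by rewrite /b h; case: eqP => [->|//]; rewrite hk.
Qed.
End NeighbourhoodCore.

Section Sampling.
Variables (R : realFieldType) (d n M p : nat).
Local Notation N := n.+1.
Hypotheses (M0 : (0 < M)%N) (MN : (M <= N)%N).
Local Notation cell := {ffun 'I_d -> 'I_N}.
Local Notation nbhd := (@cell_nbhd d n M).
Local Notation avg_nbhd := (@cell_avg R d n M).

Variables (cl : 'I_p -> cell) (A : 'I_p -> 'I_p -> bool).
Hypothesis A_nbhd : forall i j, A i j -> cl j \in nbhd (cl i).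
Hypothesis core_A : forall i j, cl j \in cell_core M (cl i) -> A i j.

Definition cell_count (c : cell) : nat := #|[set i | cl i == c]|.
Variables (v delta : R).
Hypotheses (v0 : 0 < v) (delta_le1 : 0 <= delta <= 1).
Hypothesis count_approx : forall c, `|(cell_count c)%:R - v| <= delta * v.

Definition cell_mean (f : 'I_p -> R) (c : cell) : R :=
  (\sum_(i | cl i == c) f i) / (cell_count c)%:R.

(** Relative error of replacing a sum over neighbours by [v] times a sum of cell means over the box.
    A core cell costs [delta * v]; the others, a proportion of at most [4 * d / M], cost at most a
    further [3 * v] each, whence 12. *)
Let err := delta + 12 * d%:R / M%:R.
Let deg (i : 'I_p) : R := \sum_j (A i j)%:R.

Lemma cell_sum_norm_le (f : 'I_p -> R) x c : (forall i, `|f i| <= x) ->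
  `|\sum_(i | cl i == c) f i| <= (cell_count c)%:R * x.
Proof.
move=> fx; rewrite (le_trans (ler_norm_sum _ _ _)) //.
rewrite (le_trans (ler_sum _ (fun i _ => fx i))) // sumr_const mulr_natl.
by rewrite /cell_count cardsE.
Qed.

Lemma cell_mean_norm_le (f : 'I_p -> R) x c : 0 <= x -> (forall i, `|f i| <= x) ->
  `|cell_mean f c| <= x.
Proof.
move=> x0 fx; rewrite /cell_mean normrM normfV normr_nat.
have [->|c0] := eqVneq (cell_count c) 0%N; first by rewrite invr0 mulr0.
by rewrite ler_pdivrMr ?ltr0n ?lt0n // mulrC cell_sum_norm_le.
Qed.

Lemma cell_sumE (f : 'I_p -> R) c :
  \sum_(i | cl i == c) f i = (cell_count c)%:R * cell_mean f c.
Proof.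
rewrite /cell_mean; have [c0|c0] := eqVneq (cell_count c) 0%N; last first.
  by rewrite mulrC divfK ?pnatr_eq0.
rewrite c0 mul0r big1 // => i ic; have : i \in [set i | cl i == c] by rewrite inE.
by rewrite (card0_eq c0).
Qed.

Lemma sum_nbhd_approx (f : 'I_p -> R) i : (forall j, `|f j| <= 1) ->
  `|\sum_j (A i j)%:R * f j - v * \sum_(c in nbhd (cl i)) cell_mean f c|
    <= err * v * #|nbhd (cl i)|%:R.
Proof.
move=> f1; have /andP[d0 d1] := delta_le1.
have -> : \sum_j (A i j)%:R * f j =
    \sum_(c in nbhd (cl i)) \sum_(j | cl j == c) (A i j)%:R * f j.
  rewrite (bigID (fun j => cl j \in nbhd (cl i))) /= addrC big1 => [|j jS]; last first.
    by case: (boolP (A i j)) => [/A_nbhd|]; rewrite ?(negPf jS) ?mul0r.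
  rewrite add0r (partition_big cl (fun c => c \in nbhd (cl i))) //=.
  by apply: eq_bigr => c cS; apply: eq_bigl => j; case: eqP => [->|]; rewrite ?cS ?andbF.
rewrite mulr_sumr -sumrB (le_trans (ler_norm_sum _ _ _)) //.
have cnt c : v - delta * v <= (cell_count c)%:R <= v + delta * v.
  by rewrite -ler_distl.
have mean1 c : `|cell_mean f c| <= 1 by apply: cell_mean_norm_le.
have dv0 : 0 <= delta * v by rewrite mulr_ge0 // ltW.
apply: le_trans (_ : \sum_(c in nbhd (cl i)) (delta * v +
   (c \notin cell_core M (cl i))%:R * (3 * v)) <= _).
  apply: ler_sum => c cS; have [cC|cC] := boolP (c \in cell_core M (cl i)).
    rewrite mul0r addr0 (eq_bigr f) => [|j /eqP jc]; last first.
      by rewrite core_A ?mul1r // jc.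
    rewrite cell_sumE -mulrBl normrM -[leRHS]mulr1 ler_pM //.
  rewrite mul1r (le_trans (ler_normB _ _)) //.
  have /andP[_ c1] := cnt c.
  have h1 : `|\sum_(j | cl j == c) (A i j)%:R * f j| <= v + delta * v.
    rewrite (le_trans (@cell_sum_norm_le _ 1 _ _)) ?mulr1 // => j.
    by rewrite normrM normr_nat mulr_ile1 // lern1 leq_b1.
  have h2 : `|v * cell_mean f c| <= v.
    by rewrite normrM gtr0_norm // ler_piMr // ltW.
  rewrite (le_trans (lerD h1 h2)) //.
  have := ler_wpM2r (ltW v0) d1; lra.
rewrite big_split /= sumr_const -mulr_suml.
have -> : \sum_(c in nbhd (cl i)) (c \notin cell_core M (cl i))%:R =
    #|nbhd (cl i) :\: cell_core M (cl i)|%:R :> R.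
  rewrite [LHS]big_mkcond -sum1_card natr_sum [RHS]big_mkcond.
  apply: eq_bigr => c _.
  by rewrite [in RHS]inE andbC; case: (c \in nbhd _); case: (c \in _).
have := card_nbhd_diff_core R M0 MN (cl i).
set a := #|_ :\: _|%:R; set b := #|_|%:R => ab.
rewrite /err -[_ *+ _]mulr_natr -/b.
have M0' : 0 < M%:R :> R by rewrite ltr0n.
have : a <= 4 * d%:R * b / M%:R by rewrite ler_pdivlMr // mulrC.
move=> ab'; have := ler_wpM2r (ltW v0) ab'; move: (M%:R^-1) => w; lra.
Qed.

Hypothesis err_le : err <= 2^-1.

Lemma cell_count_gt0 c : 0 < (cell_count c)%:R :> R.
Proof.
have := count_approx c; rewrite ler_distl => /andP[c1 _].
have : delta <= 2^-1.
  by apply: le_trans err_le; rewrite lerDl divr_ge0 ?mulr_ge0.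
move=> /(ler_wpM2r (ltW v0)) h.
by apply: lt_le_trans c1; rewrite subr_gt0 (le_lt_trans h) // gtr_pMl // invf_lt1 // ltr1n.
Qed.

Lemma deg_approx i : `|deg i - v * #|nbhd (cl i)|%:R| <= err * v * #|nbhd (cl i)|%:R.
Proof.
have mean1 c : cell_mean (fun=> 1) c = 1.
  rewrite /cell_mean sumr_const -[1 *+ _]mulr_natr mul1r /cell_count cardsE divff //.
  by rewrite -cardsE lt0r_neq0 // cell_count_gt0.
have -> : deg i = \sum_j (A i j)%:R * 1 by apply: eq_bigr => j _; rewrite mulr1.
have -> : #|nbhd (cl i)|%:R = \sum_(c in nbhd (cl i)) cell_mean (fun=> 1) c.
  by rewrite (eq_bigr (fun=> 1)) // sumr_const.
rewrite [leRHS](_ : _ = err * v * #|nbhd (cl i)|%:R).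
  by apply: sum_nbhd_approx => j; rewrite normr1.
by rewrite (eq_bigr (fun=> 1)) // sumr_const.
Qed.

Lemma deg_ge i : v * #|nbhd (cl i)|%:R <= 2 * deg i.
Proof.
have := deg_approx i; rewrite ler_distl => /andP[+ _].
have : 0 <= v * #|nbhd (cl i)|%:R by rewrite mulr_ge0 // ltW.
move=> h; have := ler_wpM2r h err_le; lra.
Qed.

Lemma deg_gt0 i : 0 < deg i.
Proof.
have := deg_ge i; have : 0 < v * #|nbhd (cl i)|%:R.
  by rewrite mulr_gt0 // card_cell_nbhd_gt0.
lra.
Qed.

(** Both terms are within [err * v * S] of [v * S * Q], and [v * S] is at most twice the degree. *)
Lemma walk_approx (f : 'I_p -> R) i : (forall j, `|f j| <= 1) ->
  `|\sum_j (A i j)%:R * f j - deg i * avg_nbhd (cell_mean f) (cl i)|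
    <= 4 * err * deg i.
Proof.
move=> f1; set Q := avg_nbhd _ _; set S := #|nbhd (cl i)|%:R : R.
have S0 : 0 < S by exact: card_cell_nbhd_gt0.
have Q1 : `|Q| <= 1 by apply: norm_cell_avg_le => // c; exact: cell_mean_norm_le.
have QE : \sum_(c in nbhd (cl i)) cell_mean f c = S * Q.
  by rewrite /Q /cell_avg mulrC divfK // lt0r_neq0.
have := sum_nbhd_approx i f1; rewrite QE -/S => h1.
have h2 : `|v * (S * Q) - deg i * Q| <= err * v * S.
  rewrite mulrA -mulrBl normrM distrC -[leRHS]mulr1 ler_pM //; exact: deg_approx.
rewrite -(subrKA (v * (S * Q))) (le_trans (ler_normD _ _)) //.
rewrite (le_trans (lerD h1 h2)) //.
have e0 : 0 <= err.
  by rewrite addr_ge0 ?divr_ge0 ?mulr_ge0 //; case/andP: delta_le1.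
have := ler_wpM2l e0 (deg_ge i); rewrite -/S; lra.
Qed.

(** The function is scaled to the value 1 at a point of largest modulus. It has oscillation at least
    1, and this survives up to errors in its cell means, to which the decay on the grid applies. *)
Lemma eigenfunction_decay (f : 'I_p -> R) (lambda : R) W kappa B s :
  contracting_potential N M W kappa B -> 0 <= kappa -> 0 <= lambda <= 1 ->
  (exists i, f i != 0) ->
  (forall i, \sum_j (A i j)%:R * f j = lambda * deg i * f i) ->
  \sum_i deg i * f i = 0 ->
  lambda ^+ s.+1 <= d%:R * (kappa ^+ s * (4 * N%:R / M%:R) * B)
    + (2 * s.+1%:R + 4) * (4 * err).
Proof.
move=> cW k0 l01 [i' fi'] fE f0; have /andP[l0 l1] := l01.
pose i0 := [arg max_(i > i') `|f i|]%O.
have fmax j : `|f j| <= `|f i0| by rewrite /i0; case: arg_maxP => // i _ h; exact: h.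
have fi0 : 0 < `|f i0| by rewrite (lt_le_trans _ (fmax i')) // normr_gt0.
pose g i := f i / f i0.
have fi0' : f i0 != 0 by rewrite -normr_gt0.
have g1 i : `|g i| <= 1 by rewrite normrM normfV ler_pdivrMr // mul1r.
have gi0 : g i0 = 1 by rewrite /g divff.
have gE i : \sum_j (A i j)%:R * g j = lambda * deg i * g i.
  by rewrite /g mulrA -fE mulr_suml; apply: eq_bigr => j _; rewrite mulrA.
(* Orthogonality to the constants excludes a function that is positive everywhere. *)
have [j0 gj0] : exists j, g j <= 0.
  apply/existsP; apply/negbNE; rewrite negb_exists; apply/negP => /forallP gpos.
  have : 0 < \sum_i deg i * g i.
    rewrite (bigD1 i0) //= gi0 mulr1; apply: ltr_pwDl; first exact: deg_gt0.
    apply: sumr_ge0 => i _.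
    by rewrite mulr_ge0 ?ltW ?deg_gt0 // ltNge gpos.
  have -> : \sum_i deg i * g i = (\sum_i deg i * f i) / f i0.
    by rewrite mulr_suml; apply: eq_bigr => i _; rewrite mulrA.
  by rewrite f0 mul0r ltxx.
pose E := 4 * err; pose gb := cell_mean g.
have pt i : `|lambda * g i - avg_nbhd gb (cl i)| <= E.
  rewrite -(ler_pM2l (deg_gt0 i)) -{1}[deg i]gtr0_norm ?deg_gt0 // -normrM mulrBr.
  rewrite mulrA [deg i * lambda]mulrC -gE [deg i * E]mulrC; exact: walk_approx.
have cellpt c : `|lambda * gb c - avg_nbhd gb c| <= E.
  have c0 := cell_count_gt0 c.
  rewrite -(ler_pM2l c0) -{1}[_%:R]gtr0_norm // -normrM.
  have -> : (cell_count c)%:R * (lambda * gb c - avg_nbhd gb c) =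
      \sum_(i | cl i == c) (lambda * g i - avg_nbhd gb (cl i)).
    rewrite sumrB -mulr_sumr cell_sumE (eq_bigr (fun=> avg_nbhd gb c)) => [|i /eqP-> //].
    rewrite sumr_const -[avg_nbhd gb c *+ _]mulr_natl /cell_count cardsE.
    by rewrite mulrBr mulrCA.
  rewrite (le_trans (ler_norm_sum _ _ _)) // (le_trans (ler_sum _ (fun i _ => pt i))) //.
  by rewrite sumr_const -[leLHS]mulr_natl /cell_count cardsE.
have gb1 c : `|gb c| <= 1 by apply: cell_mean_norm_le.
have := approx_eigenfunction_osc M0 MN s (cl j0) (cl i0) cW k0 l01 gb1 cellpt.
move=> /(lerD (lexx (4 * E))) h.
apply: le_trans (_ : 4 * E + lambda ^+ s.+1 * `|gb (cl i0) - gb (cl j0)| <= _); last first.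
  by apply: le_trans h _; rewrite -/E; move: (d%:R * _) => z; lra.
have ls : 0 <= lambda ^+ s <= 1 by rewrite exprn_ge0 // exprn_ile1.
(* At each of [i0] and [j0] one error leads from the point value to the box average and one from
   there to the cell mean, hence four. *)
have : lambda <= 4 * E + lambda * `|gb (cl i0) - gb (cl j0)|.
  have h0 : lambda <= lambda * g i0 - lambda * g j0.
    by rewrite gi0 mulr1 lerBrDr gerDl mulr_ge0_le0.
  have := pt i0; have := pt j0; have := cellpt (cl i0); have := cellpt (cl j0).
  rewrite !ler_norml => /andP[a1 a2] /andP[b1 b2] /andP[c1 c2] /andP[d1 d2].
  have : lambda * (gb (cl i0) - gb (cl j0)) <= lambda * `|gb (cl i0) - gb (cl j0)|.
    by rewrite ler_wpM2l // ler_norm.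
  move: h0; lra.
have E0 : 0 <= E by exact: le_trans (cellpt (cl i0)).
case/andP: ls => ls0 ls1 /(ler_wpM2l ls0); rewrite mulrDr (mulrA _ lambda) -exprSr.
move/le_trans; apply; rewrite lerD2r ler_piMl //; exact: mulr_ge0.
Qed.

Let mass := \sum_i deg i.

Let err_ge0 : 0 <= err.
Proof. by rewrite addr_ge0 ?divr_ge0 ?mulr_ge0 //; case/andP: delta_le1. Qed.

Let K : R := #|{: cell}|%:R.

Let delta_le_err : delta <= err.
Proof. by rewrite lerDl divr_ge0 ?mulr_ge0. Qed.

Let count_itv c : 2^-1 * v <= (cell_count c)%:R <= 3 / 2 * v.
Proof.
have := count_approx c; rewrite ler_distl => /andP[c1 c2].
have := ler_wpM2r (ltW v0) (le_trans delta_le_err err_le) => h.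
by apply/andP; split; [apply: le_trans c1|apply: le_trans c2 _]; move: h; lra.
Qed.

Let sum_cells (F : cell -> R) : \sum_i F (cl i) = \sum_c (cell_count c)%:R * F c.
Proof.
rewrite (partition_big cl predT) //=; apply: eq_bigr => c _.
rewrite (eq_bigr (fun=> F c)) => [|i /eqP-> //].
by rewrite sumr_const -[F c *+ _]mulr_natl /cell_count cardsE.
Qed.

Let mass_le : mass <= 4 * (v * K) ^+ 2.
Proof.
have vK0 : 0 <= v * K by rewrite mulr_ge0 // ltW.
apply: le_trans (_ : \sum_(i < p) (3 / 2 * (v * K)) <= _).
  apply: ler_sum => i _; have := deg_approx i; rewrite ler_distl => /andP[_ /le_trans]; apply.
  have S0 : 0 <= v * #|nbhd (cl i)|%:R by rewrite mulr_ge0 // ltW.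
  have SK : v * #|nbhd (cl i)|%:R <= v * K by rewrite ler_pM2l // ler_nat max_card.
  have := ler_wpM2r S0 err_le; rewrite mulrA; lra.
rewrite (sum_cells (fun=> 3 / 2 * (v * K))) -mulr_suml.
have : \sum_c (cell_count c)%:R <= 3 / 2 * (v * K).
  rewrite (le_trans (ler_sum _ (fun c _ => proj2 (andP (count_itv c))))) //.
  by rewrite sumr_const -[leLHS]mulr_natr [leRHS]mulrA; exact: lexx.
move=> h; have vK1 : 0 <= 3 / 2 * (v * K) by rewrite mulr_ge0 // divr_ge0.
by apply: le_trans (ler_wpM2r vK1 h) _; rewrite expr2; nra.
Qed.

(** Degrees are at least [v * M ^+ d / 2] and counts at least [v / 2], while the total mass is at
    most [4 * (v * K) ^+ 2]; this gives the factor 16. *)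
Lemma mass_coord_ge (F : nat -> R) k : (forall i, (i < N)%N -> 0 <= F i) ->
  (M%:R / N%:R) ^+ d / 16 * (N%:R^-1 * \sum_(0 <= i < N) F i) * mass
    <= \sum_i deg i * F (cl i k).
Proof.
move=> F0; set x := N%:R^-1 * _.
have x0 : 0 <= x.
  rewrite mulr_ge0 ?invr_ge0 // big_nat_cond sumr_ge0 // => i /andP[/andP[_ iN] _].
  exact: F0.
have KE : K = N%:R ^+ d.
  by rewrite /K card_ffun !card_ord natrX.
apply: le_trans (_ : \sum_i (2^-1 * v * M%:R ^+ d) * F (cl i k) <= _); last first.
  apply: ler_sum => i _; rewrite ler_wpM2r ?F0 //.
  have := card_cell_nbhd_ge R M0 MN (cl i) => /(ler_wpM2l (ltW v0)).
  have := deg_ge i; lra.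
rewrite -mulr_sumr (sum_cells (fun c => F (c k))).
apply: le_trans (_ : 2^-1 * v * M%:R ^+ d * \sum_c (2^-1 * v * F ((c : cell) k)) <= _); last first.
  have w0 : 0 <= 2^-1 * v * M%:R ^+ d.
    by apply: mulr_ge0; [apply: mulr_ge0; [rewrite invr_ge0|exact: ltW]|apply: exprn_ge0].
  rewrite ler_wpM2l // ler_sum // => c _.
  by rewrite ler_wpM2r ?F0 //; case/andP: (count_itv c).
rewrite -mulr_sumr (sum_coord _ F k) -/x -/K.
apply: le_trans (_ : (M%:R / N%:R) ^+ d / 16 * x * (4 * (v * K) ^+ 2) <= _).
  by rewrite ler_wpM2l // mulr_ge0 // divr_ge0 // exprn_ge0 // divr_ge0.
rewrite KE expr_div_n le_eqVlt; apply/orP; left; apply/eqP.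
by field; rewrite expf_neq0 // pnatr_eq0.
Qed.

(** The weighted mean of the coordinate vanishes on the ideal grid by [sum_cell_nbhd_center].
    Idealizing the degrees costs [2 * err], idealizing the counts [4 * err]. *)
Lemma mass_center_le k :
  `|\sum_i deg i * center R N (cl i k)| <= 6 * err * mass.
Proof.
pose c0 (c : cell) := center R N (c k); pose S (c : cell) : R := #|nbhd c|%:R.
have c01 c : `|c0 c| <= 1 by rewrite ler_norml (center_itv R M0 MN).
have S0 c : 0 <= S c by [].
have sumS : v * \sum_i S (cl i) <= 2 * mass.
  by rewrite !mulr_sumr; apply: ler_sum => i _; exact: deg_ge.
have h1 : `|\sum_i deg i * c0 (cl i) - v * \sum_i S (cl i) * c0 (cl i)| <= 2 * err * mass.
  rewrite mulr_sumr -sumrB (le_trans (ler_norm_sum _ _ _)) //.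
  apply: le_trans (_ : err * (v * \sum_i S (cl i)) <= _).
    rewrite !mulr_sumr ler_sum // => i _; rewrite mulrA -mulrBl normrM.
    rewrite -[leRHS]mulr1 mulrA ler_pM //; exact: deg_approx.
  by have := ler_wpM2l err_ge0 sumS; lra.
have h2 : `|\sum_i S (cl i) * c0 (cl i)| <= delta * v * \sum_c S c.
  rewrite (sum_cells (fun c => S c * c0 c)).
  have z : \sum_c v * (S c * c0 c) = 0.
    by rewrite -mulr_sumr sum_cell_nbhd_center ?mulr0.
  rewrite -[X in `|X|]subr0 -[X in _ - X]z -sumrB (le_trans (ler_norm_sum _ _ _)) //.
  rewrite mulr_sumr ler_sum // => c _; rewrite -mulrBl !normrM mulrA.
  rewrite [`|S c|]ger0_norm // -[leRHS]mulr1 ler_pM ?mulr_ge0 //.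
  by rewrite ler_wpM2r.
have h3 : v * (v * \sum_c S c) <= 4 * mass.
  have : v * \sum_c S c <= 2 * \sum_i S (cl i).
    rewrite (sum_cells S) !mulr_sumr ler_sum // => c _; rewrite mulrA ler_wpM2r //.
    by case/andP: (count_itv c) => + _; lra.
  by move/(ler_wpM2l (ltW v0)); lra.
have h4 : `|v * \sum_i S (cl i) * c0 (cl i)| <= 4 * err * mass.
  rewrite normrM gtr0_norm // (le_trans (ler_wpM2l (ltW v0) h2)) //.
  have d0 : 0 <= delta by case/andP: delta_le1.
  have m0 : 0 <= mass by rewrite sumr_ge0 // => i _; rewrite ltW // deg_gt0.
  have := ler_wpM2l d0 h3; have := ler_wpM2r m0 delta_le_err; lra.
rewrite -[X in `|X|](subrK (v * \sum_i S (cl i) * c0 (cl i))).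
rewrite (le_trans (ler_normD _ _)) // (le_trans (lerD h1 h4)) //; lra.
Qed.

(** The test function is constant on cells, so its cell means are exact and its box average reduces
    to a window average along the axis [k]. *)
Lemma center_form_ge k :
  \sum_i deg i * (center R N (cl i k) * win_avg N M (center R N) (cl i k)) - 4 * err * mass
  <= \sum_i center R N (cl i k) * \sum_j (A i j)%:R * center R N (cl j k).
Proof.
pose f i := center R N (cl i k).
have f1 i : `|f i| <= 1 by rewrite ler_norml (center_itv R M0 MN).
have fb c : cell_mean f c = center R N (c k).
  rewrite /cell_mean (eq_bigr (fun=> center R N (c k))) => [|i /eqP<- //].
  rewrite sumr_const -[_ *+ _]mulr_natr /cell_count cardsE mulfK //.
  by rewrite -cardsE lt0r_neq0 // cell_count_gt0.
rewrite mulr_sumr -sumrB ler_sum // => i _; rewrite -/(f i).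
have := walk_approx i f1.
have -> : avg_nbhd (cell_mean f) (cl i) = win_avg N M (center R N) (cl i k).
  rewrite -(cell_avg_coord M0 MN) /cell_avg; congr (_ / _).
  by apply: eq_bigr => c _; rewrite fb.
set w := win_avg _ _ _ _; set x := \sum_j _ => h.
have : `|f i * (x - deg i * w)| <= 4 * err * deg i.
  by rewrite normrM -[leRHS]mul1r ler_pM.
by rewrite ler_norml => /andP[+ _]; lra.
Qed.
End Sampling.

(** * Bounds on the gap of a sampled graph *)

Section SampledGap.
Variables (R : realType) (d n M p : nat).
Local Notation N := n.+1.
Hypotheses (M0 : (0 < M)%N) (MN : (M <= N)%N) (p1 : (1 < p)%N).
Local Notation cell := {ffun 'I_d -> 'I_N}.

Variables (cl : 'I_p -> cell) (A : 'I_p -> 'I_p -> bool).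
Hypothesis symA : forall i j, A i j = A j i.
Hypothesis A_nbhd : forall i j, A i j -> cl j \in cell_nbhd M (cl i).
Hypothesis core_A : forall i j, cl j \in cell_core M (cl i) -> A i j.

Variables (v delta : R).
Hypotheses (v0 : 0 < v) (delta_le1 : 0 <= delta <= 1).
Hypothesis count_approx : forall c, `|(cell_count cl c)%:R - v| <= delta * v.

Let err := delta + 12 * d%:R / M%:R.
Hypothesis err_le : err <= 2^-1.

Variable W : 'M[R]_p.
Hypothesis WE : forall i j, W i j = (A i j)%:R.
Let D : 'M[R]_p := diag_mx (\row_i (Num.sqrt (\sum_j W i j))^-1).
Local Notation gamma := (nth 0 (eigenvalues (1%:M - D *m W *m D)) 1).
Local Notation deg i := (\sum_j W i j).

Let degE i : deg i = \sum_j (A i j)%:R.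
Proof. by apply: eq_bigr => j _; rewrite WE. Qed.

Let symW i j : W i j = W j i. Proof. by rewrite !WE symA. Qed.
Let W0 i j : 0 <= W i j. Proof. by rewrite WE. Qed.
Let deg0 i : 0 < deg i.
Proof. rewrite degE; exact: (deg_gt0 M0 MN A_nbhd core_A v0 delta_le1 count_approx err_le). Qed.

Lemma sampled_gap_ge0 : 0 <= gamma.
Proof. exact: laplacian_gap_ge0. Qed.

Lemma sampled_gap_decay V kappa B s :
  contracting_potential N M V kappa B -> 0 <= kappa -> gamma <= 1 ->
  (1 - gamma) ^+ s.+1 <= d%:R * (kappa ^+ s * (4 * N%:R / M%:R) * B)
    + (2 * s.+1%:R + 4) * (4 * err).
Proof.
move=> cV k0 g1.
have [f [f0 fE fm]] := laplacian_gap_eigenfunction p1 symW W0 deg0.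
apply: (eigenfunction_decay M0 MN A_nbhd core_A v0 delta_le1 count_approx err_le
  s cV k0 _ f0) => [|i|].
- by rewrite subr_ge0 g1 lerBlDr lerDl sampled_gap_ge0.
- by rewrite -degE -fE; apply: eq_bigr => j _; rewrite WE.
- by rewrite -[RHS]fm; apply: eq_bigr => i _; rewrite degE.
Qed.

Let rho : R := (M%:R / N%:R) ^+ d / 16.
Variable k : 'I_d.
(** The coordinate is rounded to the centre of the cell, which keeps the test function constant on
    cells. *)
Let f i := center R N (cl i k).
Let mass := \sum_i deg i.
Let b := \sum_i deg i * f i ^+ 2.
Let a := \sum_i f i * \sum_j W i j * f j.
Let t := (\sum_i deg i * f i) ^+ 2 / mass.

Let mass0 : 0 < mass.
Proof.
rewrite /mass (bigD1 (Ordinal (ltnW p1))) //=; apply: ltr_pwDl => //.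
by rewrite sumr_ge0 // => i _; exact: ltW.
Qed.

Let err0 : 0 <= err.
Proof. by rewrite addr_ge0 ?divr_ge0 ?mulr_ge0 //; case/andP: delta_le1. Qed.

Let massE : mass = \sum_i \sum_j (A i j)%:R.
Proof. by apply: eq_bigr => i _; rewrite degE. Qed.

Let t_le : t <= 18 * err * mass.
Proof.
have := mass_center_le M0 MN A_nbhd core_A v0 delta_le1 count_approx err_le k.
rewrite -massE -/err; under eq_bigr do rewrite -degE.
rewrite -/(f _); set s1 := \sum_i _ => h.
rewrite /t ler_pdivrMr // -/s1 -[s1 ^+ 2]real_normK ?num_real //.
have : `|s1| ^+ 2 <= (6 * err * mass) ^+ 2.
  by rewrite ler_pXn2r ?nnegrE // !mulr_ge0 // ltW.
move/le_trans; apply; rewrite exprMn.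
have -> : 18 * err * mass * mass = 18 * err * mass ^+ 2 by ring.
rewrite ler_wpM2r ?sqr_ge0 //.
(* [err <= 2^-1] turns [36 * err ^+ 2] into [18 * err]. *)
have := ler_wpM2r err0 err_le; nra.
Qed.

Let t_ge0 : 0 <= t. Proof. by rewrite divr_ge0 ?sqr_ge0 // ltW. Qed.

Let variance : 0 <= b - t /\ gamma * (b - t) <= b - a.
Proof. exact: laplacian_gap_variance. Qed.

Let form_ge : \sum_i deg i * (center R N (cl i k) * win_avg N M (center R N) (cl i k))
  - 4 * err * mass <= a.
Proof.
have := center_form_ge M0 MN A_nbhd core_A v0 delta_le1 count_approx err_le k.
rewrite -massE -/err; under eq_bigr do rewrite -degE.
move/le_trans; apply; rewrite le_eqVlt; apply/orP; left; apply/eqP.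
by apply: eq_bigr => i _; congr (_ * _); apply: eq_bigr => j _; rewrite WE.
Qed.

Let mass_ge (F : nat -> R) : (forall i, (i < N)%N -> 0 <= F i) ->
  rho * (N%:R^-1 * \sum_(0 <= i < N) F i) * mass <= \sum_i deg i * F (cl i k).
Proof.
move=> F0; have := mass_coord_ge M0 MN A_nbhd core_A v0 delta_le1 count_approx err_le k F0.
rewrite -massE => /le_trans; apply; apply: ler_sum => i _.
by rewrite degE.
Qed.

(** From [gamma * (b - t) <= b - a] one gets a bound for [(gamma - r / 2) * (b - t)] with [4 * err]
    from the form and [9 * err] from [r / 2 * t], together 13. The divisor is [b - t], at least
    [rho / 8 * mass]: [rho / 4] from [b], less the bias. *)
Lemma sampled_gap_le r w : (1 < N)%N -> 0 < r <= 1 -> 0 <= w ->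
  2 * M%:R / N%:R <= r + w -> 18 * err <= rho / 8 ->
  gamma <= r / 2 + 8 * (w + N%:R^-1 + 13 * err) / rho.
Proof.
move=> N1 r01 w0 rM err_rho; have [V1 V2] := variance.
have /andP[r0 r1] := r01.
have rho0 : 0 < rho by rewrite divr_gt0 // exprn_gt0 // divr_gt0 // ltr0n.
have b_ge : rho / 4 * mass <= b.
  apply: le_trans (mass_ge (F := fun i => center R N i ^+ 2) _); last first.
    by move=> i _; exact: sqr_ge0.
  rewrite ler_wpM2r ?(ltW mass0) // ler_wpM2l ?(ltW rho0) //.
  exact: (sum_center_sqr _ M0 MN).
have a_ge : (1 - r / 2) * b - (w + N%:R^-1) * mass - 4 * err * mass <= a.
  apply: le_trans form_ge; rewrite lerD2r.
  rewrite /b /mass !mulr_sumr -sumrB ler_sum // => i _.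
  have := center_win_avg_ge M0 MN (ltn_ord (cl i k)) r01 rM w0.
  move/(ler_wpM2l (ltW (deg0 i))); rewrite -/(f i).
  move: (N%:R^-1) (deg i) (f i) (win_avg _ _ _ _) => nv x y z; lra.
have N0 : 0 <= N%:R^-1 :> R by rewrite invr_ge0.
have [|gr] := leP gamma (r / 2).
  move/le_trans; apply; rewrite lerDl divr_ge0 ?(ltW rho0) // mulr_ge0 //.
  by rewrite !addr_ge0 // mulr_ge0.
rewrite -lerBlDl ler_pdivlMr //.
have bt : rho / 8 * mass <= b - t.
  have := ler_wpM2r (ltW mass0) err_rho; have := t_le; have := b_ge; lra.
have g0 : 0 <= gamma - r / 2 by rewrite subr_ge0 ltW.
have h1 := ler_wpM2l g0 bt.
have h2 : r / 2 * t <= 2^-1 * t by rewrite ler_wpM2r //; lra.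
rewrite -(ler_pM2r mass0).
have := t_le; move: h1 h2 V2 a_ge.
move: (N%:R^-1) gamma => nv g; lra.
Qed.

(** Here [(1 - gamma) * (b - t)] is at least [a - t], where 22 adds 4 from the form and 18 from the
    bias. Positivity of the left side gives [gamma < 1], after which [b - t] may be enlarged to
    [mass]. *)
Lemma sampled_gap_lt1 : (N <= M.*2)%N -> (M < N)%N ->
  22 * err < rho * (3^-1 * ((N - M).-1%:R / N%:R) ^+ 3) ->
  gamma <= 1 - (rho * (3^-1 * ((N - M).-1%:R / N%:R) ^+ 3) - 22 * err).
Proof.
move=> NM MN'; rewrite -subr_gt0; set x := _ ^+ 3; set X := _ - _ => X0.
have [V1 V2] := variance.
have rho0 : 0 <= rho by rewrite divr_ge0 // exprn_ge0 // divr_ge0.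
have a_ge : (rho * (3^-1 * x) - 4 * err) * mass <= a.
  apply: le_trans form_ge; rewrite mulrBl lerD2r.
  apply: le_trans (mass_ge (F := fun i => center R N i * win_avg N M (center R N) i) _).
    by rewrite ler_wpM2r ?(ltW mass0) // ler_wpM2l // sum_center_win_avg_ge.
  by move=> i iN; exact: center_win_avg_ge0.
have b_le : b <= mass.
  apply: ler_sum => i _; rewrite ler_piMr ?(ltW (deg0 i)) //.
  rewrite -real_normK ?num_real // exprn_ile1 // ler_norml.
  exact: (center_itv _ M0 MN).
have h : X * mass <= (1 - gamma) * (b - t).
  by have := t_le; move: V2 a_ge; rewrite /X; lra.
have g1 : 0 < 1 - gamma.
  rewrite ltNge; apply/negP => g1.
  have : (1 - gamma) * (b - t) <= 0 by rewrite mulr_le0_ge0.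
  by move/(le_trans h); rewrite leNgt mulr_gt0.
rewrite lerBrDl -lerBrDr -(ler_pM2r mass0) (le_trans h) // ler_pM2l //.
by rewrite lerBlDr (le_trans b_le) // lerDl.
Qed.
End SampledGap.

(** * Geometric graphs in the cube *)

Local Open Scope classical_set_scope.
Local Open Scope ring_scope.

Section GeometricCells.
Variables (R : realType) (d : nat).
Implicit Types (x y : 'rV[R]_d) (q : nat).

(** A coordinate equal to 1 would be truncated to an index beyond the last cell; this happens with
    probability 0. *)
Definition half_open_cube : set 'rV[R]_d := [set x | forall k, -1 <= x ord0 k < 1].

(* The cube is cut into cells of side [1 / q.+1], hence [q.*2.+2] per axis. *)
Definition cell_of q x : {ffun 'I_d -> 'I_(q.*2.+2)} :=
  [ffun k => inord (Num.truncn (q.+1%:R * (x ord0 k + 1)))].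

Lemma norm_rV_le (r : R) x : 0 <= r -> (`|x| <= r) = [forall k, `|x ord0 k| <= r].
Proof.
move=> r0; rewrite /Num.norm /= mx_normrE; apply/bigmax_leP/forallP => [[_ h] k|h].
  by have := h (ord0, k) isT.
by split=> // [[i k]] _ /=; rewrite ord1; exact: h.
Qed.

Lemma cell_of_itv q x k : half_open_cube x ->
  (cell_of q x k)%:R <= q.+1%:R * (x ord0 k + 1) < (cell_of q x k)%:R + 1.
Proof.
move=> /(_ k)/andP[x1 x2]; rewrite ffunE.
have h0 : 0 <= q.+1%:R * (x ord0 k + 1) by rewrite mulr_ge0 // -lerBlDr sub0r.
rewrite inordK; last first.
  rewrite truncn_lt_nat // -doubleS -mul2n natrM mulrC ltr_pM2r ?ltr0n //.
  by rewrite -ltrBrDr; apply: lt_le_trans x2 _; lra.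
by rewrite natr1; exact: truncn_itv.
Qed.

Variable r : R.
Hypothesis r02 : 0 < r < 2.

(* Rounded up, so that windows of this radius contain all neighbours and the
   contraction factor [1 - M / N] of [clamp_potential] is at most [1 - r / 2]. *)
Definition reach q := (Num.truncn (q.+1%:R * r)).+1.

Let r0 : 0 < r. Proof. by case/andP: r02. Qed.

Lemma reach_itv q : q.+1%:R * r < (reach q)%:R <= q.+1%:R * r + 1.
Proof.
have /truncn_itv/andP[h1 h2] : 0 <= q.+1%:R * r by rewrite mulr_ge0 // ltW.
by rewrite /reach h2 -natr1 lerD2r h1.
Qed.

Lemma reach_le q : (reach q <= q.*2.+2)%N.
Proof.
case/andP: r02 => _ r2.
rewrite /reach truncn_lt_nat; last by rewrite mulr_ge0 // ltW.
by rewrite -doubleS -mul2n natrM mulrC ltr_pM2r ?ltr0n.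
Qed.

Lemma cell_of_adjacent q x y : half_open_cube x -> half_open_cube y ->
  `|x - y| <= r -> cell_of q y \in cell_nbhd (reach q) (cell_of q x).
Proof.
move=> cx cy; rewrite norm_rV_le ?ltW // => /forallP xy; rewrite inE; apply/forallP => k.
have := xy k; rewrite !mxE ler_norml => /andP[h1 h2].
have /andP[a1 a2] := cell_of_itv q k cx; have /andP[b1 b2] := cell_of_itv q k cy.
have /andP[m1 _] := reach_itv q; have q0 : 0 < q.+1%:R :> R by rewrite ltr0n.
have {}h1 := ler_wpM2l (ltW q0) h1; have {}h2 := ler_wpM2l (ltW q0) h2.
have e1 : (cell_of q x k)%:R < (cell_of q y k + reach q).+1%:R :> R.
  rewrite -natr1 natrD; move: h1 h2 a1 a2 b1 b2 m1; lra.
have e2 : (cell_of q y k)%:R < (cell_of q x k + reach q).+1%:R :> R.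
  rewrite -natr1 natrD; move: h1 h2 a1 a2 b1 b2 m1; lra.
move: e1 e2; rewrite !ltr_nat /in_win /winl /winr leq_subLR leq_min ltn_ord /= !ltnS.
by rewrite addnC => -> ->.
Qed.

Lemma cell_of_core q x y : half_open_cube x -> half_open_cube y ->
  cell_of q y \in cell_core (reach q) (cell_of q x) -> `|x - y| <= r.
Proof.
move=> cx cy; rewrite inE norm_rV_le ?ltW // => /forallP xy; apply/forallP => k.
have /andP[a1 a2] := cell_of_itv q k cx; have /andP[b1 b2] := cell_of_itv q k cy.
have /andP[_ m2] := reach_itv q; have q0 : 0 < q.+1%:R :> R by rewrite ltr0n.
have := xy k; rewrite /close_win => /andP[].
rewrite -!(ler_nat R) !natrD => e1 e2.
rewrite !mxE ler_norml -(ler_pM2l q0) -[X in _ && X](ler_pM2l q0).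
move: e1 e2 a1 a2 b1 b2 m2; lra.
Qed.

(** [v] is the expected number of points in a cell. The tolerance is tied to the resolution, so that
    the single parameter [q] controls all errors. *)
Definition well_spread q p (x : nat -> 'rV[R]_d) := (forall i, half_open_cube (x i)) /\
  let v : R := p%:R / q.*2.+2%:R ^+ d in
  forall c, `|#|[set i : 'I_p | cell_of q (x i) == c]%SET|%:R - v| <= q.+1%:R^-1 * v.

Section Gap.
Variables (q p : nat) (x : nat -> 'rV[R]_d).
Hypotheses (p1 : (1 < p)%N) (xs : well_spread q p x).
Local Notation N := q.*2.+2.
Local Notation M := (reach q).
Let v : R := p%:R / N%:R ^+ d.
Let err : R := q.+1%:R^-1 + 12 * d%:R / M%:R.
(** Bounds [err] by a constant independent of [q] over [q.+1], since [reach q] is at least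
    [q.+1 * r]. *)
Let bnd : R := (1 + 12 * d%:R / r) / q.+1%:R.
Hypothesis bnd_le : bnd <= 2^-1.

Let M0 : (0 < M)%N. Proof. by []. Qed.
Let MN : (M <= N)%N. Proof. exact: reach_le. Qed.
Let NE : N%:R = 2 * q.+1%:R :> R. Proof. by rewrite -doubleS -mul2n natrM. Qed.
Let q0 : 0 < q.+1%:R :> R. Proof. by rewrite ltr0n. Qed.
Let v0 : 0 < v. Proof. by rewrite divr_gt0 // ?exprn_gt0 // ltr0n // ltnW. Qed.

Let err_bnd : err <= bnd.
Proof.
rewrite /bnd mulrDl mul1r lerD2l -[leRHS]mulrA -invfM ler_wpM2l ?mulr_ge0 //.
rewrite lef_pV2 ?posrE ?ltr0n ?mulr_gt0 //.
by have /andP[/ltW + _] := reach_itv q; rewrite mulrC.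
Qed.

Let err_le : err <= 2^-1. Proof. exact: le_trans bnd_le. Qed.
Let q01 : 0 <= (q.+1%:R^-1 : R) <= 1. Proof. by rewrite invr_ge0 ler0n invf_le1 // ler1n. Qed.

Let adj (i j : 'I_p) : bool := `|x i - x j| <= r.
Let cl (i : 'I_p) := cell_of q (x i).

Let adjC i j : adj i j = adj j i. Proof. by rewrite /adj distrC. Qed.
Let adj_nbhd i j : adj i j -> cl j \in cell_nbhd M (cl i).
Proof. by apply: cell_of_adjacent; exact: (proj1 xs). Qed.
Let core_adj i j : cl j \in cell_core M (cl i) -> adj i j.
Proof. by apply: cell_of_core; exact: (proj1 xs). Qed.
Let count_adj c : `|(cell_count cl c)%:R - v| <= q.+1%:R^-1 * v.
Proof. exact: (proj2 xs c). Qed.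
Let adjE i j : adjacency r x p i j = (adj i j)%:R.
Proof. by rewrite mxE /h /adj; case: ifP. Qed.

Lemma spread_gap_decay V kappa B s : 0 <= B ->
  contracting_potential N M V kappa B -> 0 <= kappa -> spectral_gap r x p <= 1 ->
  (1 - spectral_gap r x p) ^+ s.+1 <=
    d%:R * (8 / r * B) * kappa ^+ s + (2 * s.+1%:R + 4) * (4 * bnd).
Proof.
move=> B0 cV k0 g1.
have := sampled_gap_decay M0 MN p1 adjC adj_nbhd core_adj v0 q01 count_adj err_le adjE
  s cV k0 g1.
move/le_trans; apply; apply: lerD; last first.
  by rewrite !ler_wpM2l // addr_ge0 // mulr_ge0.
have -> : d%:R * (kappa ^+ s * (4 * N%:R / M%:R) * B) =
  d%:R * (4 * N%:R / M%:R * B) * kappa ^+ s by ring.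
rewrite ler_wpM2r ?exprn_ge0 // ler_wpM2l // ler_wpM2r //.
rewrite ler_pdivrMr ?ltr0n // mulrAC ler_pdivlMr // NE.
have /andP[/ltW h _] := reach_itv q; lra.
Qed.

Lemma spread_gap_le : (0 < d)%N -> r <= 1 ->
  18 * bnd <= (r / 2) ^+ d / 16 / 8 ->
  spectral_gap r x p <= r / 2 + 8 * (2 / q.+1%:R + 13 * bnd) / ((r / 2) ^+ d / 16).
Proof.
move=> d0 r1 hb.
have N0 : 0 < N%:R :> R by rewrite ltr0n.
have MNr : r / 2 <= M%:R / N%:R.
  rewrite ler_pdivlMr // NE; have /andP[/ltW h _] := reach_itv q; lra.
have r20 : 0 < r / 2 by rewrite divr_gt0.
have rho_le : (r / 2) ^+ d / 16 <= (M%:R / N%:R) ^+ d / 16.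
  by rewrite ler_wpM2r // lerXn2r ?nnegrE ?divr_ge0 // ltW.
have rho0 : 0 < (r / 2) ^+ d / 16 by rewrite divr_gt0 // exprn_gt0.
have := sampled_gap_le M0 MN p1 adjC adj_nbhd core_adj v0 q01 count_adj err_le adjE
  (Ordinal d0) (r := r) (w := q.+1%:R^-1) _ _ _ _ _.
have err0 : 0 <= err by rewrite addr_ge0 ?divr_ge0 ?mulr_ge0 // invr_ge0.
have NV : N%:R^-1 <= q.+1%:R^-1 :> R.
  by rewrite lef_pV2 ?posrE // NE; move: q0; lra.
have qV : 0 <= q.+1%:R^-1 :> R by rewrite invr_ge0.
have h1 : 2 * M%:R / N%:R <= r + q.+1%:R^-1.
  rewrite ler_pdivrMr // NE.
  have -> : (r + q.+1%:R^-1) * (2 * q.+1%:R) = 2 * (q.+1%:R * r + 1).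
    by field; rewrite ?natr1 ?nat1r pnatr_eq0.
  by rewrite ler_pM2l //; have /andP[] := reach_itv q.
have h2 : 18 * err <= (M%:R / N%:R) ^+ d / 16 / 8.
  apply: le_trans (_ : 18 * bnd <= _); first by rewrite ler_wpM2l.
  by apply: le_trans hb _; rewrite ler_wpM2r.
have h3 : 0 < r <= 1 by rewrite r0.
move=> /(_ isT h3 qV h1 h2) /le_trans; apply; rewrite lerD2l.
apply: ler_pM => //.
- by rewrite ler_wpM2l // lerD ?ler_wpM2l // [leRHS]mulr_natl mulr2n lerD2l.
- by rewrite lef_pV2 ?posrE // (lt_le_trans rho0).
Qed.

Lemma spread_gap_lt1 : (0 < d)%N -> 1 <= r -> q.+1%:R^-1 <= (2 - r) / 4 ->
  let X := (r / 2) ^+ d / 16 * (3^-1 * ((2 - r) / 4) ^+ 3) in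
  44 * bnd <= X -> spectral_gap r x p <= 1 - X / 2.
Proof.
move=> d0 r1 qr X hX; case/andP: r02 => _ r2.
have N0 : 0 < N%:R :> R by rewrite ltr0n.
have MNr : r / 2 <= M%:R / N%:R.
  rewrite ler_pdivlMr // NE; have /andP[/ltW h _] := reach_itv q; lra.
have r20 : 0 < r / 2 by rewrite divr_gt0.
have X0 : 0 < X.
  rewrite mulr_gt0 ?divr_gt0 ?exprn_gt0 // mulr_gt0 // exprn_gt0 // divr_gt0 //.
  by rewrite subr_gt0.
have q4 : 4 <= (2 - r) * q.+1%:R.
  by move: qr; rewrite -[q.+1%:R^-1]mul1r ler_pdivrMr //; lra.
have MN' : (M < N)%N.
  rewrite -(ltr_nat R) NE; have /andP[_ h] := reach_itv q; lra.
have NM : (N <= M.*2)%N.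
  rewrite -(ler_nat R) -[(M.*2)%N]mul2n natrM NE; have /andP[h _] := reach_itv q.
  have : q.+1%:R * 1 <= q.+1%:R * r by rewrite ler_pM2l.
  lra.
have X_le : X <= (M%:R / N%:R) ^+ d / 16 * (3^-1 * ((N - M).-1%:R / N%:R) ^+ 3).
  apply: ler_pM.
  - by rewrite divr_ge0 // exprn_ge0 // ltW.
  - by rewrite mulr_ge0 // exprn_ge0 // divr_ge0 // subr_ge0 ltW.
  - by rewrite ler_wpM2r // lerXn2r ?nnegrE ?divr_ge0 // ltW.
  rewrite ler_wpM2l // lerXn2r ?nnegrE ?divr_ge0 ?subr_ge0 ?(ltW r2) //.
  rewrite ler_pdivlMr // -subn1 natrB ?subn_gt0 // natrB 1?ltnW // NE.
  have /andP[_ h] := reach_itv q; lra.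
have e22 : 22 * err <= X / 2.
  have := err_bnd; rewrite -/err; lra.
have := sampled_gap_lt1 M0 MN p1 adjC adj_nbhd core_adj v0 q01 count_adj err_le adjE
  (Ordinal d0) NM MN' _.
rewrite -/err => g; apply: le_trans (g _) _.
  apply: lt_le_trans X_le; apply: le_lt_trans e22 _; lra.
rewrite lerD2l lerN2 lerBrDr; apply: le_trans X_le.
by rewrite [X in _ <= X]splitr lerD2l.
Qed.
End Gap.
End GeometricCells.

Lemma exists_resolution (R : realType) (z e : R) : 0 <= z -> 0 < e ->
  exists q0, forall q, (q0 <= q)%N -> z / q.+1%:R <= e.
Proof.
move=> z0 e0; exists (Num.truncn (z / e)) => q qz.
rewrite ler_pdivrMr ?ltr0n // mulrC -ler_pdivrMr //.
have /truncn_itv/andP[_ /ltW/le_trans] : 0 <= z / e by rewrite divr_ge0 // ltW.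
by apply; rewrite ler_nat.
Qed.

(** * Choice of the grid resolution *)

Section ResolutionChoice.
Variables (R : realType) (d : nat) (r : R).
Hypotheses (d0 : (0 < d)%N) (r02 : 0 < r < 2).
Implicit Types (x : nat -> 'rV[R]_d).

Let r0 : 0 < r. Proof. by case/andP: r02. Qed.

Let C : R := 1 + 12 * d%:R / r.
Let C0 : 0 <= C. Proof. by rewrite addr_ge0 // divr_ge0 ?mulr_ge0 // ltW. Qed.

Lemma exists_expr_le (kappa rho z : R) : 0 <= kappa -> kappa < rho ->
  exists s, z * kappa ^+ s <= rho ^+ s.+1 / 3.
Proof.
move=> k0 kr; have rho0 := le_lt_trans k0 kr.
have [z0|z0] := leP z 0.
  by exists 0%N; rewrite mulr1 (le_trans z0) // divr_ge0 // ltW.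
have kr1 : `|kappa / rho| < 1.
  by rewrite ger0_norm ?divr_ge0 ?(ltW rho0) // ltr_pdivrMr // mul1r.
have e0 : 0 < rho / 3 / z by rewrite !divr_gt0.
have /cvgr0Pnorm_lt/(_ _ e0)[s _ /(_ s (leqnn _))] := cvg_expr kr1.
rewrite /= ger0_norm ?exprn_ge0 ?divr_ge0 ?(ltW rho0) // expr_div_n => /ltW h.
exists s; have rs0 : 0 < rho ^+ s by rewrite exprn_gt0.
have := ler_wpM2l (ltW z0) (ler_wpM2r (ltW rs0) h).
rewrite divfK ?lt0r_neq0 // => /le_trans; apply.
by rewrite exprS le_eqVlt; apply/orP; left; apply/eqP; field; exact: lt0r_neq0.
Qed.

(** If [1 - gamma] exceeded [rho], slightly larger than [kappa], then [rho ^+ s.+1] would be bounded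
    by a main term and an error term. Each is made at most a third of it: the first by [s], the
    second by [q], chosen after [s]. *)
Lemma gap_ge_resolution (V : nat -> nat -> R) kappa B eta :
  0 <= B -> 0 <= kappa -> 0 < eta ->
  (forall q, contracting_potential q.*2.+2 (reach r q) (V q) kappa B) ->
  exists q, forall p x, (1 < p)%N -> well_spread q p x ->
    1 - kappa - eta <= spectral_gap r x p.
Proof.
move=> B0 k0 eta0 cV; pose rho := kappa + eta.
have kr : kappa < rho by rewrite ltrDl.
have rho0 := le_lt_trans k0 kr.
have [s hs] := exists_expr_le (d%:R * (8 / r * B)) k0 kr.
have half0 : 0 < 2^-1 :> R by rewrite invr_gt0.
have [q1 hq1] := exists_resolution C0 half0.
pose z := (2 * s.+1%:R + 4) * (4 * C).
have z0 : 0 <= z by rewrite mulr_ge0 ?addr_ge0 ?mulr_ge0.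
have rs0 : 0 < rho ^+ s.+1 by rewrite exprn_gt0.
have rs3 : 0 < rho ^+ s.+1 / 3 by rewrite divr_gt0.
have [q2 hq2] := exists_resolution z0 rs3.
exists (maxn q1 q2) => p x p1; set q := maxn q1 q2 => xs.
have b1 := hq1 q (leq_maxl _ _); have b2 := hq2 q (leq_maxr _ _).
rewrite -addrA -opprD -/rho lerBlDr addrC -lerBlDr leNgt; apply/negP => h.
have g1 : spectral_gap r x p <= 1 by rewrite -subr_ge0 (le_trans (ltW rho0)) // ltW.
have := spread_gap_decay r02 p1 xs b1 s B0 (cV q) k0 g1.
have : rho ^+ s.+1 <= (1 - spectral_gap r x p) ^+ s.+1.
  by rewrite lerXn2r ?nnegrE ?(ltW h) ?(ltW rho0) // ltW // (lt_trans rho0).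
move=> h1 /(le_trans h1); rewrite -/C.
have -> : (2 * s.+1%:R + 4) * (4 * (C / q.+1%:R)) = z / q.+1%:R by rewrite /z !mulrA.
move=> h2; have := le_trans h2 (lerD hs b2).
move: (rho ^+ s.+1) rs0 => y y0; lra.
Qed.

Lemma gap_le_resolution eta : 0 < eta -> r <= 1 ->
  exists q, forall p x, (1 < p)%N -> well_spread q p x ->
    spectral_gap r x p <= r / 2 + eta.
Proof.
move=> eta0 r1; pose rho := (r / 2) ^+ d / 16.
have rho0 : 0 < rho by rewrite divr_gt0 // exprn_gt0 // divr_gt0.
have half0 : 0 < 2^-1 :> R by rewrite invr_gt0.
have [q1 hq1] := exists_resolution C0 half0.
have C18 : 0 <= 18 * C by rewrite mulr_ge0.
have rho8 : 0 < rho / 8 by rewrite divr_gt0.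
have [q2 hq2] := exists_resolution C18 rho8.
have C13 : 0 <= 8 * (2 + 13 * C) / rho.
  by rewrite divr_ge0 ?(ltW rho0) // mulr_ge0 // addr_ge0 // mulr_ge0.
have [q3 hq3] := exists_resolution C13 eta0.
exists (maxn q1 (maxn q2 q3)) => p x p1; set q := maxn _ _ => xs.
have b1 := hq1 q (leq_maxl _ _).
have b2 := hq2 q (leq_trans (leq_maxl _ _) (leq_maxr _ _)).
have b3 := hq3 q (leq_trans (leq_maxr _ _) (leq_maxr _ _)).
have b2' : 18 * (C / q.+1%:R) <= rho / 8 by rewrite mulrA.
apply: le_trans (spread_gap_le r02 p1 xs b1 d0 r1 b2') _.
have E y : 8 * (2 / y + 13 * (C / y)) / rho = 8 * (2 + 13 * C) / rho / y by ring.
by rewrite lerD2l -/C -/rho E.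
Qed.

Lemma gap_lt1_resolution : 1 <= r -> exists2 eta, 0 < eta &
  exists q, forall p x, (1 < p)%N -> well_spread q p x ->
    spectral_gap r x p <= 1 - eta.
Proof.
move=> r1; case/andP: (r02) => _ r2.
pose X := (r / 2) ^+ d / 16 * (3^-1 * ((2 - r) / 4) ^+ 3).
have e0 : 0 < (2 - r) / 4 by rewrite divr_gt0 ?subr_gt0.
have X0 : 0 < X.
  by rewrite mulr_gt0 ?divr_gt0 ?exprn_gt0 ?divr_gt0 // mulr_gt0 ?invr_gt0 ?exprn_gt0.
exists (X / 2); first by rewrite divr_gt0.
have half0 : 0 < 2^-1 :> R by rewrite invr_gt0.
have [q1 hq1] := exists_resolution C0 half0.
have C44 : 0 <= 44 * C by rewrite mulr_ge0.
have [q2 hq2] := exists_resolution C44 X0.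
have [q3 hq3] := exists_resolution ler01 e0.
exists (maxn q1 (maxn q2 q3)) => p x p1; set q := maxn _ _ => xs.
have b1 := hq1 q (leq_maxl _ _).
have b2 := hq2 q (leq_trans (leq_maxl _ _) (leq_maxr _ _)).
have b3 := hq3 q (leq_trans (leq_maxr _ _) (leq_maxr _ _)).
rewrite mul1r in b3; rewrite -mulrA in b2.
exact: (spread_gap_lt1 r02 p1 xs b1 d0 r1 b3 b2).
Qed.

Lemma gap_ge_half eta : 0 < eta -> 1 <= r ->
  exists q, forall p x, (1 < p)%N -> well_spread q p x ->
    r / 2 - eta <= spectral_gap r x p.
Proof.
move=> eta0 r1; have /andP[_ r2] := r02.
have k0 : 0 <= 1 - r / 2 by rewrite subr_ge0 ler_pdivrMr // mul1r ltW.
have cV q : contracting_potential q.*2.+2 (reach r q)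
    (clamp_potential R q.*2.+2 (reach r q)) (1 - r / 2) 1.
  have /andP[/ltW h _] := reach_itv r02 q.
  have [|||Wm Ws Wr Wc] := @clamp_potentialP R q.*2.+2 (reach r q) => //.
  - exact: reach_le.
  - rewrite -(ler_nat R) -doubleS -!mul2n !natrM ler_pM2l //.
    by apply: le_trans h; rewrite ler_peMr.
  split=> // i iN; apply: le_trans (Wc i iN) _.
  rewrite ler_wpM2r ?subr_ge0 ?Wm // lerD2l lerN2 ler_pdivlMr ?ltr0n //.
  by rewrite -doubleS -mul2n natrM; move: h; lra.
pose V q := clamp_potential R q.*2.+2 (reach r q).
have [q hq] := gap_ge_resolution (V := V) ler01 k0 eta0 cV.
by exists q => p x p1 xs; have := hq p x p1 xs; rewrite opprB addrCA subrr addr0.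
Qed.

Lemma gap_gt0_resolution : r <= 1 -> exists2 eta, 0 < eta &
  exists q, forall p x, (1 < p)%N -> well_spread q p x -> eta <= spectral_gap r x p.
Proof.
move=> r1; have r01 : 0 < r <= 1 by rewrite r0.
have e0 : 0 < r ^+ 2 / 18 by rewrite divr_gt0 // exprn_gt0.
(* Half of [1 - kappa]; the other half is the tolerance given to [gap_ge_resolution]. *)
exists (r ^+ 2 / 18) => //.
have r2 : r ^+ 2 <= 1 by rewrite exprn_ile1 // ltW.
have k0 : 0 <= 1 - r ^+ 2 / 9 by lra.
have B0 : 0 <= 18 :> R by [].
have cV q : contracting_potential q.*2.+2 (reach r q)
    (cubic_potential R q.*2.+2) (1 - r ^+ 2 / 9) 18.
  apply: cubic_potentialP => //; first exact: reach_le.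
  rewrite ler_pdivlMr ?ltr0n // -doubleS -mul2n natrM.
  by have /andP[/ltW h _] := reach_itv r02 q; move: h; lra.
have [q hq] := gap_ge_resolution (V := fun q => cubic_potential R q.*2.+2) B0 k0 e0 cV.
exists q => p x p1 xs; have := hq p x p1 xs.
by apply: le_trans; rewrite le_eqVlt; apply/orP; left; apply/eqP; field.
Qed.
End ResolutionChoice.

(** * Almost sure convergence of cell counts *)

Section IndependentEvents.
Variables (disp : measure_display) (T : measurableType disp) (R : realType).
Variables (P : probability T R) (E : nat -> set T) (pr : R).
Hypothesis mE : forall i, measurable (E i).
Hypothesis indepE : forall J : seq nat, uniq J ->
  P (\bigcap_(i in [set` J]) E i) = (pr ^+ size J)%:E.
Hypothesis pr01 : 0 <= pr <= 1.

(* The factors [1 + s (1_E - pr)] have mean 1, so by independence this is a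
   mean-one product; it plays the role of an exponential moment. *)
Fixpoint tilt (s : R) n (w : T) : R :=
  if n is n'.+1 then tilt s n' w * (1 - s * pr + s * \1_(E n') w) else 1.

Variable s : R.
Hypothesis s01 : 0 <= s <= 2^-1.

Let sp : 0 <= 1 - s * pr.
Proof. by case/andP: s01 pr01 => s0 s1 /andP[p0 p1]; nra. Qed.

Let s0 : 0 <= s. Proof. by case/andP: s01. Qed.

Let factor_ge0 n w : 0 <= 1 - s * pr + s * \1_(E n) w.
Proof. by rewrite addr_ge0 // mulr_ge0. Qed.

Lemma tilt_ge0 n w : 0 <= tilt s n w.
Proof. by elim: n => //= n IHn; rewrite mulr_ge0. Qed.

Lemma measurable_tilt n : measurable_fun setT (tilt s n).
Proof.
elim: n => [|n IHn] /=; first exact: measurable_cst.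
apply: measurable_funM => //; apply: measurable_funD; first exact: measurable_cst.
by apply: measurable_funM; [exact: measurable_cst | exact: measurable_indic].
Qed.

Let measurable_tiltE n D : measurable_fun D (EFin \o tilt s n).
Proof.
apply/measurable_EFinP; apply: measurable_funTS; exact: measurable_tilt.
Qed.

Let mcap (J : seq nat) : measurable (\bigcap_(i in [set` J]) E i).
Proof. by apply: fin_bigcap_measurable => //; exact: finite_seq. Qed.

(** Integrating over an intersection of events with indices at least [n] is what lets the induction
    go through: the indicator in the last factor only adds one event to the intersection. Thus
    independence is used solely as a product formula for intersections. *)
Lemma integral_tilt_cap n (J : seq nat) : uniq J -> all (leq n) J ->
  (\int[P]_(w in \bigcap_(i in [set` J]) E i) (tilt s n w)%:E = (pr ^+ size J)%:E)%E.
Proof.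
elim: n J => [|n IHn] J uJ nJ.
  by rewrite /= integral_cst //= mul1e indepE.
set G := \bigcap_(i in _) _.
have GE : G `&` E n = \bigcap_(i in [set` n :: J]) E i.
  rewrite /G; apply/seteqP; split => w /=.
    move=> [wJ wn] i /=; rewrite inE => /orP[/eqP->//|iJ]; exact: wJ.
  move=> wJ; split; last by apply: wJ => /=; rewrite inE eqxx.
  by move=> i iJ; apply: wJ => /=; rewrite inE iJ orbT.
have nJ' : all (leq n) J by apply: sub_all nJ => i /ltnW.
have unJ : uniq (n :: J).
  rewrite /= uJ andbT; apply/negP => nin; move/allP: nJ => /(_ _ nin).
  by rewrite ltnn.
transitivity (\int[P]_(w in G) ((1 - s * pr)%:E * (tilt s n w)%:E +
    s%:E * ((tilt s n w)%:E * (\1_(E n) w)%:E)))%E.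
  apply: eq_integral => w _; rewrite -!EFinM -EFinD; congr _%:E => /=; ring.
have mG : measurable G by exact: mcap.
have t0 w : (0 <= (tilt s n w)%:E)%E by rewrite lee_fin tilt_ge0.
have m1 : measurable_fun G (fun w => (tilt s n w)%:E) by exact: measurable_tiltE.
have m2 : measurable_fun G (fun w => (tilt s n w)%:E * (\1_(E n) w)%:E)%E.
  apply: emeasurable_funM => //; apply/measurable_EFinP; exact: measurable_indic.
have i0 w : (0 <= (tilt s n w)%:E * (\1_(E n) w)%:E)%E by rewrite mule_ge0 // lee_fin.
rewrite ge0_integralD //; last 4 first.
- by move=> w _; rewrite mule_ge0 // lee_fin.
- by apply: emeasurable_funM => //; exact: measurable_cst.
- by move=> w _; rewrite mule_ge0 // lee_fin.
- by apply: emeasurable_funM => //; exact: measurable_cst.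
rewrite !ge0_integralZl_EFin // IHn //.
have -> : (\int[P]_(w in G) ((tilt s n w)%:E * (\1_(E n) w)%:E) =
    \int[P]_(w in G `&` E n) (tilt s n w)%:E)%E.
  rewrite integral_mkcondr; apply: eq_integral => w _.
  rewrite patchE indicE; case: ifP => _; first by rewrite mule1.
  by rewrite mule0.
rewrite GE IHn //=; last by rewrite leqnn nJ'.
rewrite -!EFinM -EFinD exprS; congr _%:E; ring.
Qed.

Lemma integral_tilt n : (\int[P]_w (tilt s n w)%:E = 1)%E.
Proof.
have := @integral_tilt_cap n [::] isT isT; rewrite expr0 => <-.
by congr integral; rewrite (_ : [set` [::]] = set0) ?bigcap_set0 //; apply/seteqP; split.
Qed.

Lemma measurable_tilt_ge n (c : R) : measurable [set w | c <= tilt s n w].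
Proof.
rewrite (_ : [set w | _] = setT `&` tilt s n @^-1` `[c, +oo[); last first.
  by apply/seteqP; split => w /=; rewrite in_itv /= andbT //; case.
by apply: measurable_tilt => //; exact: measurable_itv.
Qed.

Lemma tilt_markov n (c : R) : 0 < c ->
  (P [set w | (c <= tilt s n w)%R] <= (c^-1)%:E)%E.
Proof.
move=> c0; set F := [set w | _].
have mF : measurable F by exact: measurable_tilt_ge.
have : (c%:E * P F <= 1)%E.
  rewrite -(integral_tilt n) -integral_cst //.
  apply: le_trans (_ : \int[P]_(w in F) (tilt s n w)%:E <= _)%E.
    apply: ge0_le_integral => //; first by move=> w _; rewrite /= lee_fin ltW.
    exact: measurable_tiltE.
  apply: ge0_subset_integral => //; first exact: measurable_tiltE.
  by move=> w _; rewrite lee_fin tilt_ge0.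
have : (P F) \is a fin_num by exact: fin_num_measure.
move=> /fineK <-; rewrite -EFinM !lee_fin => h.
by rewrite -(ler_pM2l c0) mulfV ?lt0r_neq0.
Qed.

(** Taking inverses, it suffices that [1 - u + 2 * u ^+ 2], a lower bound of the exponential, is at
    least the inverse of [1 + u]; the product with [1 + u] is [1 + u ^+ 2 * (1 + 2 * u)]. *)
Lemma expR_le_1D (u : R) : - 2^-1 <= u -> expR (u - 2 * u ^+ 2) <= 1 + u.
Proof.
move=> u2; rewrite -[u - _]opprK expRN -[leRHS]invrK.
have u0 : 0 < 1 + u by lra.
rewrite lef_pV2 ?posrE ?invr_gt0 ?expR_gt0 //.
apply: le_trans (expR_ge1Dx _); rewrite -[leLHS]mul1r ler_pdivrMr //.
nra.
Qed.

Lemma tilt_ge n w :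
  expR (s * (\sum_(i < n) \1_(E i) w - n%:R * pr) - 2 * n%:R * s ^+ 2) <= tilt s n w.
Proof.
elim: n => [|n IHn] /=; first by rewrite big_ord0 !mul0r !mulr0 mul0r !subrr mulr0 subrr expR0.
rewrite big_ord_recr /=; set S := \sum_(i < n) _ in IHn *.
set b := \1_(E n) w; have b01 : b = 0 \/ b = 1.
  by rewrite /b indicE; case: (_ \in _); [right|left].
pose u := s * (b - pr).
have -> : s * (S + b - n.+1%:R * pr) - 2 * n.+1%:R * s ^+ 2 =
  (s * (S - n%:R * pr) - 2 * n%:R * s ^+ 2) + (u - 2 * s ^+ 2).
  by rewrite -natr1 /u; ring.
rewrite expRD ler_pM ?expR_ge0 //.
have -> : 1 - s * pr + s * b = 1 + u by rewrite /u; ring.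
have us : - 2^-1 <= u /\ u ^+ 2 <= s ^+ 2.
  case/andP: s01 pr01 => _ s1 /andP[p0 p1].
  have : -1 <= b - pr /\ b - pr <= 1 by case: b01 => ->; split; lra.
  rewrite /u; move: (b - pr) => t [t1 t2]; split.
    have t0 : 0 <= t + 1 by lra.
    have := mulr_ge0 s0 t0; move: s1; lra.
  by rewrite exprMn ler_piMr ?sqr_ge0 //; nra.
apply: le_trans (expR_le_1D (proj1 us)).
by rewrite ler_expR lerD2l lerN2 ler_pM2l //; exact: (proj2 us).
Qed.
End IndependentEvents.

Section CountBound.
Variables (disp : measure_display) (T : measurableType disp) (R : realType).
Variables (P : probability T R).

Lemma geometric_nneseries_lt_pinfty (x : R) (u : nat -> \bar R) : 0 <= x < 1 ->
  (forall n, 0 <= u n)%E -> (forall n, u n <= (x ^+ n)%:E)%E -> (\sum_(n <oo) u n < +oo)%E.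
Proof.
move=> /andP[x0 x1] u0 ux; apply: le_lt_trans (ltry (1 - x)^-1).
apply: lime_le; first exact: is_cvg_nneseries.
apply: nearW => n; apply: le_trans (lee_sum _ (fun i _ => ux i)) _.
rewrite sumEFin lee_fin -[leRHS]mul1r ler_pdivlMr ?subr_gt0 //.
have -> : (\sum_(0 <= i < n) x ^+ i) * (1 - x) = 1 - x ^+ n.
  elim: n => [|n IHn]; first by rewrite big_geq // mul0r expr0 subrr.
  by rewrite big_nat_recr //= mulrDl IHn exprS; ring.
by rewrite lerBlDr lerDl exprn_ge0.
Qed.

(** A Chernoff bound by Markov's inequality for [tilt], made almost sure by the Borel-Cantelli
    lemma. *)
Lemma eventually_count_le (E : nat -> set T) (pr eps : R) :
  (forall i, measurable (E i)) ->
  (forall J : seq nat, uniq J -> P (\bigcap_(i in [set` J]) E i) = (pr ^+ size J)%:E) ->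
  0 <= pr <= 1 -> 0 < eps <= 1 ->
  {ae P, forall w, \forall n \near \oo,
    \sum_(i < n) \1_(E i) w <= (pr + eps) * n%:R}.
Proof.
(* This [s] maximizes [s * eps - 2 * s ^+ 2], and the maximum [eps ^+ 2 / 8] is the rate in [c]. *)
move=> mE indepE pr01 /andP[e0 e1]; pose s := eps / 4.
have s01 : 0 <= s <= 2^-1 by rewrite divr_ge0 ?(ltW e0) //= /s; lra.
pose c (n : nat) := expR (n%:R * (eps ^+ 2 / 8)).
pose F n := [set w | c n <= tilt E pr s n w].
have mF n : measurable (F n) by exact: measurable_tilt_ge.
exists (lim_sup_set F); split.
- by apply: bigcap_measurable => // k _; exact: bigcup_measurable.
- apply: lim_sup_set_cvg0 => //.
  apply: (@geometric_nneseries_lt_pinfty (expR (- (eps ^+ 2 / 8)))) => //.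
    rewrite expR_ge0 /= expR_lt1 oppr_lt0 divr_gt0 // exprn_gt0 //.
  move=> n; have := tilt_markov mE indepE pr01 s01 n (expR_gt0 _ : 0 < c n).
  by rewrite -expRM_natl mulrN expRN.
move=> w /= nw n _; apply: contrapT => nF; apply: nw.
exists n => // j /= nj; rewrite leNgt; apply/negP => S.
apply: nF; exists j => //.
rewrite /F /=; apply: le_trans (tilt_ge E pr01 s01 j w).
rewrite ler_expR; have := ler_wpM2l (proj1 (andP s01)) (ltW S); rewrite /s; lra.
Qed.
End CountBound.

(** * Boxes: measurability and uniform measure *)

Section BoxMeasure.
Variable R : realType.

Definition box d (a b : 'I_d -> R) : set 'rV[R]_d :=
  [set x | forall k, a k <= x ord0 k < b k].

Lemma lebesgue_rV0 d : lebesgue_rV (set0 : set 'rV[R]_d) = 0%E.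
Proof.
elim: d => [|d IHd] /=; first by rewrite indic0.
by rewrite integral0_eq.
Qed.

Lemma lebesgue_rV_box d (a b : 'I_d -> R) : (forall k, a k <= b k) ->
  lebesgue_rV (box a b) = (\prod_k (b k - a k))%:E.
Proof.
elim: d a b => [|d IHd] a b ab /=.
  by rewrite big_ord0 indicE mem_set // => -[].
pose a' k := a (lift ord0 k); pose b' k := b (lift ord0 k).
have section x : [set v : 'rV[R]_d | box a b (row_mx (const_mx x : 'rV[R]_1) v : 'rV_d.+1)] =
    if (a ord0 <= x < b ord0) then box a' b' else set0.
  have x0 (v : 'rV[R]_d) : (row_mx (const_mx x : 'rV[R]_1) v : 'rV_d.+1) ord0 ord0 = x.
    have -> : (ord0 : 'I_d.+1) = lshift d (ord0 : 'I_1) by apply: val_inj.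
    by apply: etrans (row_mxEl _ _ _ _) _; rewrite mxE.
  have xS (v : 'rV[R]_d) k :
      (row_mx (const_mx x : 'rV[R]_1) v : 'rV_d.+1) ord0 (lift ord0 k) = v ord0 k.
    have -> : lift ord0 k = rshift 1 k by apply: val_inj.
    exact: row_mxEr.
  apply/seteqP; split => v /=.
    move=> vB; have := vB ord0; rewrite x0 => ->.
    by move=> k; have := vB (lift ord0 k); rewrite xS.
  case: ifP => // xab vB k; case: (unliftP ord0 k) => [j|] ->; last by rewrite x0.
  by rewrite xS; exact: vB.
transitivity (\int[lebesgue_measure]_(x in `[a ord0, b ord0[)
    ((\prod_k (b' k - a' k))%:E : \bar R))%E.
  rewrite [RHS]integral_mkcond; apply: eq_integral => x _.
  rewrite section patchE mem_setE in_itv /=; case: ifP => _; last exact: lebesgue_rV0.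
  by apply: IHd => k; exact: ab.
rewrite integral_cst; last exact: measurable_itv.
rewrite [X in (_ * X)%E](lebesgue_measure_itv `[a ord0, b ord0[) /= lte_fin.
rewrite big_ord_recl mulrC.
case: ltP => [_|ba]; first by rewrite -EFinD -EFinM.
have -> : b ord0 = a ord0 by apply/eqP; rewrite eq_le ba ab.
by rewrite mule0 subrr mulr0.
Qed.

Lemma borel_rV_setC d (B : set 'rV[R]_d) : borel_rV B -> borel_rV (~` B).
Proof. exact: (@measurableC _ (g_sigma_algebraType [set U : set 'rV[R]_d | open U])). Qed.

Lemma borel_rV_box d (a b : 'I_d -> R) : borel_rV (box a b).
Proof.
pose M := g_sigma_algebraType [set U : set 'rV[R]_d | open U].
have below k (c : R) : measurable ([set x | x ord0 k < c] : set M).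
  apply: sub_sigma_algebra.
  change (open ((fun x : 'rV[R]_d => x ord0 k) @^-1` [set y | y < c])).
  by apply: open_comp; [move=> x _; exact: coord_continuous | exact: open_lt].
rewrite /borel_rV (_ : box a b = \bigcap_(k in setT)
    ([set x | x ord0 k < b k] `&` ~` [set x | x ord0 k < a k])).
  apply: (@fin_bigcap_measurable _ M) => // k _.
  by apply: (@measurableI _ M); [exact: below | apply: (@measurableC _ M); exact: below].
apply/seteqP; split => x /=.
  by move=> xab k _ /=; have /andP[ax xb] := xab k; split=> //; apply/negP; rewrite -leNgt.
by move=> xab k; have [xb /negP] := xab k I; rewrite -leNgt => ->.
Qed.

Lemma uniform_cube_box d (a b : 'I_d -> R) :
  (forall k, -1 <= a k) -> (forall k, a k <= b k) -> (forall k, b k <= 1) ->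
  uniform_cube (box a b) = (\prod_k ((b k - a k) / 2))%:E.
Proof.
move=> a1 ab b1; rewrite /uniform_cube setIidl => [|x xab k]; last first.
  have /andP[ax xb] := xab k.
  by rewrite (le_trans (a1 k)) //= (le_trans (ltW xb)).
rewrite lebesgue_rV_box // -EFinM prodf_div prodr_const card_ord mulrC //.
Qed.
End BoxMeasure.

(** * Cell counts of the random sample *)

Section SampleSpread.
Variables (disp : measure_display) (T : measurableType disp) (R : realType).
Variables (P : probability T R) (d : nat) (X : nat -> T -> 'rV[R]_d).
Hypothesis iidX : iid_uniform_cube P X.

Lemma iid_event_cap (B : set 'rV[R]_d) (pr : R) : borel_rV B ->
  uniform_cube B = pr%:E -> forall J : seq nat, uniq J ->
  P (\bigcap_(i in [set` J]) (X i @^-1` B)) = (pr ^+ size J)%:E.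
Proof.
move=> mB BE J uJ; case: iidX => _ indX lawX.
rewrite (indX J (fun=> B) uJ) //.
elim: J {uJ} => [|i J IHJ]; first by rewrite big_nil.
by rewrite big_cons IHJ lawX // BE -EFinM exprS.
Qed.

Lemma iid_eventually_count_le (B : set 'rV[R]_d) (pr eps : R) : borel_rV B ->
  uniform_cube B = pr%:E -> 0 < eps <= 1 ->
  {ae P, forall w, \forall n \near \oo,
    \sum_(i < n) \1_B (X i w) <= (pr + eps) * n%:R}.
Proof.
move=> mB BE e01; case: (iidX) => rvX indX lawX.
apply: (@eventually_count_le _ _ _ P (fun i => X i @^-1` B)) => //.
- by move=> i; exact: rvX.
- exact: iid_event_cap.
have PB : P (X 0%N @^-1` B) = pr%:E by rewrite lawX.
by rewrite -!lee_fin -PB measure_ge0 probability_le1 //; exact: rvX.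
Qed.

Let cell_lo q (c : {ffun 'I_d -> 'I_(q.*2.+2)}) k : R := (c k)%:R / q.+1%:R - 1.
Let cell_hi q (c : {ffun 'I_d -> 'I_(q.*2.+2)}) k : R := ((c k)%:R + 1) / q.+1%:R - 1.
Let cell_box q c := box (@cell_lo q c) (@cell_hi q c).

Let cell_boxP q (c : {ffun 'I_d -> 'I_(q.*2.+2)}) x : half_open_cube x ->
  (x \in cell_box c) = (cell_of q x == c).
Proof.
move=> hx; have q0 : 0 < q.+1%:R :> R by rewrite ltr0n.
have boxE (c' : {ffun 'I_d -> 'I_(q.*2.+2)}) : cell_box c' x <->
    forall k, (c' k)%:R <= q.+1%:R * (x ord0 k + 1) < (c' k)%:R + 1.
  split=> h k; have := h k; rewrite /cell_lo /cell_hi;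
    by rewrite lerBlDr ltrBrDr ler_pdivrMr // ltr_pdivlMr // [q.+1%:R * _]mulrC.
apply/idP/eqP => [/set_mem/boxE h|<-]; last first.
  by apply/mem_set/boxE => k; exact: cell_of_itv.
apply/ffunP => k; apply: val_inj => /=.
have /andP[h1 h2] := h k; have /andP[h3 h4] := cell_of_itv q k hx.
have := le_lt_trans h1 h4; have := le_lt_trans h3 h2.
by rewrite !natr1 !ltr_nat !ltnS => le1 le2; apply/eqP; rewrite eqn_leq le1 le2.
Qed.

Let uniform_cell_box q (c : {ffun 'I_d -> 'I_(q.*2.+2)}) :
  uniform_cube (cell_box c) = ((q.*2.+2%:R ^+ d)^-1)%:E.
Proof.
have q0 : 0 < q.+1%:R :> R by rewrite ltr0n.
have NE : q.*2.+2%:R = 2 * q.+1%:R :> R by rewrite -doubleS -mul2n natrM.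
rewrite uniform_cube_box.
- congr _%:E; rewrite (eq_bigr (fun=> q.*2.+2%:R^-1)) => [|k _].
    by rewrite prodr_const card_ord exprVn.
  by rewrite NE /cell_hi /cell_lo; field; rewrite lt0r_neq0.
- by move=> k; rewrite lerBrDl subrr divr_ge0.
- by move=> k; rewrite lerB // ler_pM2r ?invr_gt0 // lerDl.
- move=> k; rewrite lerBlDr ler_pdivrMr // natr1.
  have : (c k).+1%:R <= q.*2.+2%:R :> R by rewrite ler_nat.
  by rewrite NE.
Qed.

Lemma ae_half_open_cube : {ae P, forall w, forall i, half_open_cube (X i w)}.
Proof.
case: (iidX) => rvX _ lawX.
apply: ae_foralln => i.
have mB := borel_rV_box (fun _ : 'I_d => -1 : R) (fun=> 1).
exists (~` (X i @^-1` box (fun=> -1) (fun=> 1))); split.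
- by apply: measurableC; exact: rvX.
- apply: etrans (probability_setC P _) _; first exact: rvX.
  rewrite lawX // uniform_cube_box //.
  rewrite (eq_bigr (fun=> 1)) => [|_ _]; last by rewrite opprK divff.
  by rewrite big1 // subee.
- by move=> w /= nw h; apply: nw.
Qed.

(** The one-sided count bound is applied to each cell and to its complement, the latter giving the
    lower bound. There are finitely many cells per resolution and countably many resolutions. The
    choice of [eps] makes [eps * n] equal to [v / q.+1]. *)
Lemma ae_well_spread : {ae P, forall w, forall q, \forall n \near \oo,
  well_spread q n (fun i => X i w)}.
Proof.
apply: ae_foralln => q.
pose pr : R := (q.*2.+2%:R ^+ d)^-1.
have N1 : 1 <= q.*2.+2%:R ^+ d :> R by rewrite exprn_ege1 // ler1n.
have pr0 : 0 < pr by rewrite invr_gt0 (lt_le_trans ltr01).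
have pr1 : pr <= 1 by rewrite invf_le1 // (lt_le_trans ltr01).
pose eps := pr / q.+1%:R.
have e01 : 0 < eps <= 1.
  rewrite divr_gt0 ?ltr0n //= ler_pdivrMr ?ltr0n // mul1r (le_trans pr1) // ler1n //.
have up : {ae P, forall w, forall c : {ffun 'I_d -> 'I_(q.*2.+2)}, \forall n \near \oo,
    \sum_(i < n) \1_(cell_box c) (X i w) <= (pr + eps) * n%:R}.
  apply: (filter_forall (ae_filter_ringOfSetsType P)) => c.
  exact: iid_eventually_count_le (borel_rV_box _ _) (uniform_cell_box c) e01.
have down : {ae P, forall w, forall c : {ffun 'I_d -> 'I_(q.*2.+2)}, \forall n \near \oo,
    \sum_(i < n) \1_(~` cell_box c) (X i w) <= (1 - pr + eps) * n%:R}.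
  apply: (filter_forall (ae_filter_ringOfSetsType P)) => c.
  case: (iidX) => rvX _ lawX; have mB := borel_rV_box (@cell_lo q c) (@cell_hi q c).
  have mC := borel_rV_setC mB.
  apply: (iid_eventually_count_le mC _ e01).
  have PC := probability_setC P (rvX 0%N _ mB).
  rewrite lawX // uniform_cell_box in PC.
  by rewrite -(lawX 0%N _ mC).
apply: filterS3 ae_half_open_cube up down => w hw upw downw.
have {}upw : \forall n \near \oo, forall c : {ffun 'I_d -> 'I_(q.*2.+2)},
    \sum_(i < n) \1_(cell_box c) (X i w) <= (pr + eps) * n%:R.
  exact: filter_forall.
have {}downw : \forall n \near \oo, forall c : {ffun 'I_d -> 'I_(q.*2.+2)},
    \sum_(i < n) \1_(~` cell_box c) (X i w) <= (1 - pr + eps) * n%:R.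
  exact: filter_forall.
apply: filterS2 upw downw => n upn downn; split=> // v c.
have cntE : #|[set i : 'I_n | cell_of q (X i w) == c]%SET|%:R =
    \sum_(i < n) \1_(cell_box c) (X i w) :> R.
  rewrite -sum1_card natr_sum big_mkcond; apply: eq_bigr => i _.
  by rewrite inE indicE cell_boxP //; case: ifP.
have {}downn := downn c; have {}upn := upn c; rewrite -cntE in upn.
have compl : \sum_(i < n) \1_(~` cell_box c) (X i w) = n%:R -
    #|[set i : 'I_n | cell_of q (X i w) == c]%SET|%:R :> R.
  rewrite cntE -[n in n%:R]card_ord -sum1_card natr_sum -sumrB.
  apply: eq_bigr => i _; rewrite !indicE in_setC.
  by case: (_ \in _); rewrite ?subrr ?subr0.
rewrite compl in downn.
have vE : v = n%:R * pr by [].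
rewrite ler_norml vE; move: upn downn; rewrite /eps.
by move: (#|_|%:R) (q.+1%:R^-1) (pr) => y z u; lra.
Qed.
End SampleSpread.

(** * Passage to the limit in the three regimes *)

Lemma limn_esup_le (R : realType) (u : nat -> \bar R) (c : \bar R) :
  (\forall n \near \oo, (u n <= c)%E) -> (limn_esup u <= c)%E.
Proof.
move=> uc; rewrite /limn_esup limf_esupE; apply: ereal_inf_le.
exists (ereal_sup [set u x | x in [set n | (u n <= c)%E]]).
  by exists [set n | (u n <= c)%E].
by apply: ge_ereal_sup => _ [n /= ? <-].
Qed.

Lemma limn_einf_ge (R : realType) (u : nat -> \bar R) (c : \bar R) :
  (\forall n \near \oo, (c <= u n)%E) -> (c <= limn_einf u)%E.
Proof.
move=> uc; rewrite /limn_einf leeNr; apply: limn_esup_le.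
by apply: filterS uc => n; rewrite leeN2.
Qed.

Theorem corollary2p5 (R : realType) (disp : measure_display)
    (T : measurableType disp) (P : probability T R) (d : nat)
    (X : nat -> T -> 'rV[R]_d) (r : R) :
  (1 <= d)%N -> 0 < r -> iid_uniform_cube P X ->
  [/\ r = 1 ->
        {ae P, forall w,
          spectral_gap r (fun i => X i w) n @[n --> \oo] --> (1 / 2 : R)},
      1 < r < 2 ->
        {ae P, forall w,
          let gamma2 := fun n => (spectral_gap r (fun i => X i w) n)%:E in
          [/\ ((1 / 2)%:E < limn_einf gamma2)%E,
              (limn_einf gamma2 <= limn_esup gamma2)%E
            & (limn_esup gamma2 < 1%:E)%E]}
    & 0 < r < 1 ->
        {ae P, forall w,
          let gamma2 := fun n => (spectral_gap r (fun i => X i w) n)%:E in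
          [/\ (0%:E < limn_einf gamma2)%E,
              (limn_einf gamma2 <= limn_esup gamma2)%E
            & (limn_esup gamma2 < (1 / 2)%:E)%E]}].
Proof.
(* The three cases are deterministic on this one almost sure event. *)
move=> d0 r0 iidX; have spread := ae_well_spread iidX.
have big : \forall n \near \oo, (1 < n)%N by exists 2%N.
split=> [r1|/andP[r1 r2]|/andP[_ r1]]; apply: filterS spread => w spread.
- have r02 : 0 < r < 2 by rewrite r0 r1 /= ltr1n.
  have r1' : r <= 1 by rewrite r1.
  have r1'' : 1 <= r by rewrite r1.
  apply/cvgrPdist_le => eta eta0.
  have [q1 lo] := gap_ge_half d r02 eta0 r1''.
  have [q2 hi] := gap_le_resolution d0 r02 eta0 r1'.
  apply: filterS3 big (spread q1) (spread q2) => n n1 s1 s2.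
  have := lo _ _ n1 s1; have := hi _ _ n1 s2; rewrite r1.
  by rewrite ler_distlC => h1 h2; apply/andP; split; lra.
- have r02 : 0 < r < 2 by rewrite r0.
  have [e e0 [q2 hi]] := gap_lt1_resolution d0 r02 (ltW r1).
  have eta0 : 0 < (r - 1) / 4 by rewrite divr_gt0 ?subr_gt0.
  have [q1 lo] := gap_ge_half d r02 eta0 (ltW r1).
  split; last 2 first.
  + exact: limn_einf_sup.
  + apply: le_lt_trans (_ : (1 - e)%:E < _)%E; last by rewrite lte_fin; lra.
    apply: limn_esup_le; apply: filterS2 big (spread q2) => n n1 s2.
    by rewrite lee_fin; exact: hi.
  apply: lt_le_trans (_ : _ < (r / 2 - (r - 1) / 4)%:E)%E _; first by rewrite lte_fin; lra.
  apply: limn_einf_ge; apply: filterS2 big (spread q1) => n n1 s1.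
  by rewrite lee_fin; exact: lo.
- have r02 : 0 < r < 2 by rewrite r0 (lt_trans r1) // ltr1n.
  have [e e0 [q1 lo]] := gap_gt0_resolution d r02 (ltW r1).
  have eta0 : 0 < (1 - r) / 4 by rewrite divr_gt0 ?subr_gt0.
  have [q2 hi] := gap_le_resolution d0 r02 eta0 (ltW r1).
  split; last 2 first.
  + exact: limn_einf_sup.
  + apply: le_lt_trans (_ : (r / 2 + (1 - r) / 4)%:E < _)%E; last by rewrite lte_fin; lra.
    apply: limn_esup_le; apply: filterS2 big (spread q2) => n n1 s2.
    by rewrite lee_fin; exact: hi.
  apply: lt_le_trans (_ : _ < e%:E)%E _; first by rewrite lte_fin.
  apply: limn_einf_ge; apply: filterS2 big (spread q1) => n n1 s1.
  by rewrite lee_fin; exact: lo.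
Qed.
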